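(* Let $X$ be a geometric finite simplicial complex. Then there exists a bijection $\mathcal{E}\mathrm{nds}(c(X))\cong\pi_0^{\mathrm{Crs}}(c(X))$.
   Context: A geometric finite simplicial complex is the image in some $\mathbb{R}^n$ of the geometric realization of a finite simplicial complex under a piecewise linear embedding (an embedding that is linear in barycentric coordinates on each simplex), equipped with the subspace metric. For a bounded subset $X\subseteq\mathbb{R}^n$, the metric cone is $c(X)=\{(hx,h)\in\mathbb{R}^{n+1}: h\ge0,\ x\in X\}$ with the Euclidean subspace metric. Ends: for a proper metric space $Z$ (closed bounded subsets are exactly the compact subsets), two continuous maps $r,r':\mathbb{R}_{\ge0}\to Z$ which are metrically proper (preimages of bounded sets are bounded) are equivalent if for every bounded $B\subseteq Z$ there is $t\ge0$ such that $r([t,\infty))$ and $r'([t,\infty))$ lie in the same path component of $Z\setminus B$. $\mathcal{E}\mathrm{nds}(Z)$ is the set of equivalence classes. Coarse path components: a map $f:Z\to Y$ of metric spaces is controlled if for every $R>0$ there is $S>0$ such that $d_Z(z,z')<R$ implies $d_Y(f(z),f(z'))<S$; proper if preimages of bounded sets are bounded; coarse if both. For a coarse map $q:Z\to\mathbb{R}_{\ge0}$, let $I_qZ=\{(z,t)\in Z\times\mathbb{R}_{\ge0}:t\le q(z)\}$ with the restriction of the max product metric. Coarse maps $f,g:Z\to Y$ are coarse homotopic if there are coarse maps $q:Z\to\mathbb{R}_{\ge0}$ and $H:I_qZ\to Y$ with $H(z,0)=f(z)$, $H(z,q(z))=g(z)$; this is an equivalence relation. $\pi_0^{\mathrm{Crs}}(Z)$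 is the set of coarse homotopy classes of coarse maps $\mathbb{R}_{\ge0}\to Z$. *)

(* Defs.v *)
From HB Require Import structures.
From mathcomp Require Import all_boot all_order all_algebra generic_quotient.
From mathcomp Require Import all_classical all_reals all_analysis.
From mathcomp Require Import ring lra.

Set Implicit Arguments.
Unset Strict Implicit.
Unset Printing Implicit Defensive.

Import Order.TTheory GRing.Theory Num.Theory.
Import numFieldNormedType.Exports.

Local Open Scope classical_set_scope.
Local Open Scope ring_scope.

Section subspace_metric.
Context {R : realType} {T : metricType R} (A : set T).
Implicit Types x y : set_type A.

Definition sub_dist x y : R := mdist (\val x) (\val y).

Lemma sub_dist_ge0 x y : 0 <= sub_dist x y.
Proof. exact: mdist_ge0. Qed.

Lemma sub_dist_positivity x y : sub_dist x y = 0 -> x = y.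
Proof. by move=> xy; apply: val_inj; apply: mdist_positivity xy. Qed.

Lemma sub_ballE x d : ball x d = [set y | sub_dist x y < d].
Proof.
rewrite -initial_ballE; apply/seteqP; split => y /=;
  by rewrite /sub_dist (ballEmdist (\val x) d).
Qed.

HB.instance Definition _ := PseudoMetric_isMetric.Build R (set_type A)
  sub_dist_ge0 sub_dist_positivity sub_ballE.

End subspace_metric.

(* The library's product balls are boxes, so the metric inducing them is the
   max metric. *)
Section prod_metric.
Context {R : realType} {T U : metricType R}.
Implicit Types x y : (T * U)%type.

Definition prod_dist x y : R := Num.max (mdist x.1 y.1) (mdist x.2 y.2).

Lemma prod_dist_ge0 x y : 0 <= prod_dist x y.
Proof. by rewrite /prod_dist le_max mdist_ge0. Qed.

Lemma prod_dist_positivity x y : prod_dist x y = 0 -> x = y.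
Proof.
case: x y => [x1 x2] [y1 y2] /= xy0.
have /andP[x1y1 x2y2] : (mdist x1 y1 <= 0) && (mdist x2 y2 <= 0).
  by rewrite -ge_max -xy0.
by congr pair; apply: mdist_positivity; apply: le_anti; rewrite mdist_ge0 andbT.
Qed.

Lemma prod_ballE x d : ball x d = [set y | prod_dist x y < d].
Proof.
apply/seteqP; split => y /=; rewrite /prod_dist gt_max.
  by move=> [+ +]; rewrite !ballEmdist => /= -> ->.
by move=> /andP[? ?]; split; rewrite ballEmdist.
Qed.

HB.instance Definition _ := PseudoMetric_isMetric.Build R (T * U)%type
  prod_dist_ge0 prod_dist_positivity prod_ballE.

End prod_metric.

(* R^n with the Euclidean metric. This is an alias of 'rV[R]_n because the
   library puts the sup metric on matrices. *)
Definition euclidean (R : realType) (n : nat) : Type := 'rV[R]_n.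

HB.instance Definition _ (R : realType) (n : nat) :=
  GRing.Lmodule.on (euclidean R n).

Section euclidean_metric.
Context {R : realType} {n : nat}.
Implicit Types x y z : 'rV[R]_n.

Definition enorm x : R := Num.sqrt (\sum_i x 0 i ^+ 2).

Lemma enorm_ge0 x : 0 <= enorm x.
Proof. exact: sqrtr_ge0. Qed.

Lemma sqr_enorm x : enorm x ^+ 2 = \sum_i x 0 i ^+ 2.
Proof. by rewrite sqr_sqrtr// sumr_ge0// => i _; rewrite sqr_ge0. Qed.

Lemma enorm0_eq0 x : enorm x = 0 -> x = 0.
Proof.
move=> x0; have := sqr_enorm x; rewrite x0 expr0n => /esym/eqP.
rewrite psumr_eq0; last by move=> i _; rewrite sqr_ge0.
move=> /allP h; apply/rowP => i; rewrite mxE; apply/eqP.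
by rewrite -sqrf_eq0; apply: h; rewrite mem_index_enum.
Qed.

Lemma enormN x : enorm (- x) = enorm x.
Proof.
by congr Num.sqrt; apply: eq_bigr => i _; rewrite mxE sqrrN.
Qed.

Lemma cauchy_schwarz x y : \sum_i x 0 i * y 0 i <= enorm x * enorm y.
Proof.
have [xy0|xy0] := eqVneq (enorm x * enorm y) 0.
  rewrite xy0; move/eqP: xy0; rewrite mulf_eq0 => /orP[] /eqP/enorm0_eq0 ->.
    by rewrite big1// => i _; rewrite mxE mul0r.
  by rewrite big1// => i _; rewrite mxE mulr0.
have {}xy0 : 0 < enorm x * enorm y.
  by rewrite lt_neqAle eq_sym xy0 mulr_ge0// enorm_ge0.
suff : 0 <= (enorm x * enorm y) *
    (enorm x * enorm y - \sum_i x 0 i * y 0 i) *+ 2.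
  by rewrite pmulrn_lge0// pmulr_rge0// subr_ge0.
have -> : (enorm x * enorm y) *
    (enorm x * enorm y - \sum_i x 0 i * y 0 i) *+ 2 =
  \sum_i (enorm y * x 0 i - enorm x * y 0 i) ^+ 2.
  under [in RHS]eq_bigr do rewrite sqrrB !exprMn.
  rewrite big_split/= sumrB -!mulr_sumr -!sqr_enorm sumrMnl.
  under [in RHS]eq_bigr do rewrite mulrACA.
  rewrite -mulr_sumr; ring.
by apply: sumr_ge0 => i _; rewrite sqr_ge0.
Qed.

Lemma enormD x y : enorm (x + y) <= enorm x + enorm y.
Proof.
rewrite -(ler_pXn2r (n := 2))// ?nnegrE ?addr_ge0 ?enorm_ge0//.
rewrite sqr_enorm; under eq_bigr do rewrite mxE sqrrD.
rewrite !big_split/= -mulr2n -!sqr_enorm sqrrD.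
by rewrite lerD2r lerD2l ler_pMn2r// cauchy_schwarz.
Qed.

Definition edist (x y : euclidean R n) : R := enorm (x - y).

Lemma edistxx x : edist x x = 0.
Proof. by rewrite /edist subrr /enorm big1 ?sqrtr0// => i _; rewrite mxE expr0n. Qed.

Lemma edist_positivity x y : edist x y = 0 -> x = y.
Proof. by move/enorm0_eq0/eqP; rewrite subr_eq0 => /eqP. Qed.

Lemma edist_sym x y : edist x y = edist y x.
Proof. by rewrite /edist -enormN opprB. Qed.

Lemma edist_triangle y x z : edist x z <= edist x y + edist y z.
Proof. by rewrite /edist -[x - z](subrKA y) enormD. Qed.

HB.instance Definition _ := @isMetric.Build R (euclidean R n)
  edist edistxx edist_positivity edist_sym edist_triangle.

End euclidean_metric.


Section metric_notions.
Context {R : realType}.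
Implicit Types Z Y : metricType R.

Definition mbounded Z (A : set Z) : Prop :=
  exists M : R, forall x y, A x -> A y -> mdist x y <= M.

Definition metrically_proper Z Y (f : Z -> Y) : Prop :=
  forall B : set Y, mbounded B -> mbounded (f @^-1` B).

Definition controlled Z Y (f : Z -> Y) : Prop :=
  forall r : R, 0 < r -> exists2 s : R, 0 < s &
    forall z z', mdist z z' < r -> mdist (f z) (f z') < s.

Definition coarse Z Y (f : Z -> Y) : Prop :=
  controlled f /\ metrically_proper f.

End metric_notions.

(* R_{>= 0}; the alias R^o is the one carrying the metric `|y - x|. *)
Definition halfline (R : realType) : set R^o := [set x | 0 <= x].
Arguments halfline R : clear implicits.

Definition hval {R : realType} (t : halfline R) : R := \val t.

Section paths.
Context {R : realType} {Z : topologicalType}.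
Implicit Types (A C : set Z) (x y : Z).

Definition path_joined A x y : Prop := exists g : R -> Z,
  [/\ {within `[0, 1], continuous g}, g 0 = x, g 1 = y & g @` `[0, 1] `<=` A].

Definition is_path_component A C : Prop :=
  exists2 x, A x & C = [set y | path_joined A x y].

End paths.

(* Ends are usually considered for proper metric spaces only; the definition
   itself does not use properness. *)
Section ends.
Context {R : realType} (Z : metricType R).

Definition end_rays : set (halfline R -> Z) :=
  [set r | continuous r /\ metrically_proper r].

Definition tail (r : halfline R -> Z) (t : halfline R) : set Z :=
  r @` [set s | hval t <= hval s].

Definition ends_equiv (r r' : halfline R -> Z) : Prop :=
  forall B : set Z, mbounded B -> exists t : halfline R,
    exists2 C : set Z, is_path_component (R := R) (~` B) C &
      tail r t `<=` C /\ tail r' t `<=` C.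

End ends.
Arguments end_rays {R} Z.

Section coarse_homotopy.
Context {R : realType} {Z Y : metricType R}.
Implicit Types (q : Z -> halfline R) (f g : Z -> Y).

(* I_q Z, with the restriction of the max metric of Z * R_{>= 0}. *)
Definition cylinder q : set (Z * halfline R)%type :=
  [set p | hval p.2 <= hval (q p.1)].

Definition cyl_pt q (p : cylinder q) : Z := (\val p).1.
Definition cyl_time q (p : cylinder q) : R := hval (\val p).2.

Definition coarse_homotopic f g : Prop :=
  exists (q : Z -> halfline R) (H : cylinder q -> Y),
    [/\ coarse q, coarse H,
      forall p, cyl_time p = 0 -> H p = f (cyl_pt p) &
      forall p, cyl_time p = hval (q (cyl_pt p)) -> H p = g (cyl_pt p)].

End coarse_homotopy.

Section metric_lemmas.
Context {R : realType}.
Implicit Types Z Y : metricType R.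

Lemma controlled_bounded Z Y (f : Z -> Y) (A : set Z) :
  controlled f -> mbounded A -> mbounded (f @` A).
Proof.
move=> cf [M AM]; have M1 : 0 < `|M| + 1 by rewrite ltr_wpDl.
have [s s0 fs] := cf _ M1; exists s => _ _ [x Ax <-] [y Ay <-].
apply/ltW/fs; rewrite (le_lt_trans (AM _ _ Ax Ay))//.
by rewrite (le_lt_trans (ler_norm M))// ltrDl.
Qed.

Lemma mbounded_sub Z (A B : set Z) : A `<=` B -> mbounded B -> mbounded A.
Proof. by move=> AB [M BM]; exists M => x y /AB ? /AB ?; apply: BM. Qed.

Lemma mbounded_setU Z (A B : set Z) :
  mbounded A -> mbounded B -> mbounded (A `|` B).
Proof.
move=> [M AM] [N BN].
have [->|/set0P[a Aa]] := eqVneq A set0; first by rewrite set0U; exists N.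
have [->|/set0P[b Bb]] := eqVneq B set0; first by rewrite setU0; exists M.
have dab := mdist_ge0 a b.
have M0 : 0 <= M by rewrite (le_trans _ (AM _ _ Aa Aa))// mdist_ge0.
have N0 : 0 <= N by rewrite (le_trans _ (BN _ _ Bb Bb))// mdist_ge0.
exists (M + mdist a b + N) => x y [Ax|Bx] [Ay|By].
- by have := AM _ _ Ax Ay; lra.
- have := AM _ _ Ax Aa; have := BN _ _ Bb By.
  have := metric_triangle x a y; have := metric_triangle a b y; lra.
- have := AM _ _ Aa Ay; have := BN _ _ Bx Bb; rewrite (metric_sym a b).
  have := metric_triangle x b y; have := metric_triangle b a y; lra.
- by have := BN _ _ Bx By; lra.
Qed.

Lemma halfline_ge0 (t : halfline R) : 0 <= hval t.
Proof. by have := set_valP t. Qed.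

Lemma halfline_dist (s t : halfline R) :
  mdist s t = `|hval t - hval s|.
Proof. by []. Qed.

Lemma halfline_bounded (A : set (halfline R)) :
  mbounded A <-> exists M : R, forall t, A t -> hval t <= M.
Proof.
split=> [[M AM]|[M AM]].
  have [->|/set0P[a Aa]] := eqVneq A set0; first by exists 0.
  exists (M + hval a) => t At.
  have := AM _ _ Aa At; rewrite halfline_dist => h.
  by rewrite -lerBlDr (le_trans (ler_norm _)).
exists M => s t As At; rewrite halfline_dist ler_norml.
have := AM _ As; have := AM _ At.
have := halfline_ge0 s; have := halfline_ge0 t.
by move=> *; apply/andP; split; lra.
Qed.

Lemma halfline_norm (x : R) : `|x| \in halfline R.
Proof. by apply: mem_set; exact: normr_ge0. Qed.

Definition hl (x : R) : halfline R := exist _ `|x| (halfline_norm x).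

Lemma val_hl x : 0 <= x -> hval (hl x) = x.
Proof. exact: ger0_norm. Qed.

Lemma hl_continuous : continuous hl.
Proof. by apply: continuous_comp_initial; exact: norm_continuous. Qed.

End metric_lemmas.

Lemma within_continuous_reparam {R : realType} {Z : topologicalType}
    (A B : set R) (phi : R -> R) (g : R -> Z) :
  continuous phi -> phi @` A `<=` B ->
  {within B, continuous g} -> {within A, continuous (g \o phi)}.
Proof.
move=> cphi AB /subspace_continuousP cg; apply/subspace_continuousP => x Ax.
have Bx : B (phi x) by apply: AB; exists x.
move=> W /(cg _ Bx) gW.
have h : nbhs x (fun y => B (phi y) -> W (g (phi y))) by exact: (cphi x _ gW).
suff : nbhs x (fun y => A y -> W (g (phi y))) by [].
apply: filterS h => y By Ay.
by apply: By; apply: AB; exists y.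
Qed.

Section path_lemmas.
Context {R : realType} {Z : topologicalType}.
Implicit Types (A : set Z) (x y z : Z).

Lemma path_joined_refl A x : A x -> path_joined (R := R) A x x.
Proof.
move=> Ax; exists (cst x); split => //; last by move=> _ [t _ <-].
by apply: continuous_subspaceT => ?; exact: cst_continuous.
Qed.

Lemma path_joined_sym A x y :
  path_joined (R := R) A x y -> path_joined (R := R) A y x.
Proof.
move=> [g [cg g0 g1 gA]].
have h : (fun t : R => 1 - t) @` `[0, 1] `<=` `[0, 1].
  move=> _ [t /= + <-]; rewrite !in_itv/= => /andP[t0 t1].
  by apply/andP; split; lra.
exists (g \o (fun t => 1 - t)); split => /=.
- apply: (within_continuous_reparam _ h cg) => t.
  by apply: continuousB; [exact: cst_continuous|exact: cvg_id].
- by rewrite subr0.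
- by rewrite subrr.
- by move=> _ [t It <-]; apply: gA; exists (1 - t) => //; apply: h; exists t.
Qed.

Lemma path_joined_trans A x y z : path_joined (R := R) A x y ->
  path_joined (R := R) A y z -> path_joined (R := R) A x z.
Proof.
have itvE : `[0, 1]%classic = `[0, 2^-1]%classic `|` `[2^-1, 1]%classic :> set R.
  apply/seteqP; split=> t; rewrite /= !in_itv/=.
    by move=> /andP[? ?]; have [?|?] := leP t 2^-1;
      [left|right]; apply/andP; split; lra.
  by move=> [|] /andP[? ?]; apply/andP; split; lra.
have lo (t : R) : 0 <= t -> t <= 2^-1 -> 0 <= 2 * t + 0 <= 1.
  by move=> ? ?; apply/andP; split; lra.
have hi (t : R) : 2^-1 <= t -> t <= 1 -> 0 <= 2 * t + (-1) <= 1.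
  by move=> ? ?; apply/andP; split; lra.
move=> [g [cg g0 g1 gA]] [g' [cg' g'0 g'1 g'A]].
have lin (a b : R) : continuous (fun t : R => a * t + b).
  move=> t; apply: continuousD; last exact: cst_continuous.
  by apply: continuousM; [exact: cst_continuous|exact: cvg_id].
pose k t := if t <= 2^-1 then g (2 * t + 0) else g' (2 * t + (-1)).
have k1 : {within `[0, 2^-1], continuous k}.
  apply: (@subspace_eq_continuous _ _ _ (g \o (fun t => 2 * t + 0))).
    move=> t; rewrite inE/= in_itv/= => /andP[_ t2].
    by rewrite /from_subspace/= /k t2.
  apply: (within_continuous_reparam (lin _ _) _ cg) => _ [t /= + <-].
  by rewrite !in_itv/= => /andP[? ?]; exact: lo.
have k2 : {within `[2^-1, 1], continuous k}.
  apply: (@subspace_eq_continuous _ _ _ (g' \o (fun t => 2 * t + (-1)))).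
    move=> t; rewrite inE/= in_itv/= => /andP[t2 _].
    rewrite /from_subspace/= /k; case: ifPn => // t2'.
    have -> : t = 2^-1 by apply/le_anti/andP.
    by rewrite divff// subrr addr0 g'0 g1.
  apply: (within_continuous_reparam (lin _ _) _ cg') => _ [t /= + <-].
  by rewrite !in_itv/= => /andP[? ?]; exact: hi.
exists k; split.
- rewrite itvE.
  by apply: withinU_continuous => //; exact: itv_closed.
- by rewrite /k ifT ?invr_ge0// mulr0 addr0.
- rewrite /k ifF; first by rewrite mulr1 addrK g'1.
  by apply/negbTE; rewrite -ltNge invf_lt1// ltr1n.
- move=> _ [t /= + <-]; rewrite in_itv/= => /andP[? ?]; rewrite /k.
  case: ifPn => [?|]; last rewrite -ltNge => /ltW ?.
    by apply: gA; exists (2 * t + 0) => //=; rewrite in_itv/=; exact: lo.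
  by apply: g'A; exists (2 * t + (-1)) => //=; rewrite in_itv/=; exact: hi.
Qed.

Lemma is_path_component_eq A C D x : is_path_component (R := R) A C ->
  is_path_component (R := R) A D -> C x -> D x -> C = D.
Proof.
move=> [c Ac ->] [d Ad ->] /= cx dx; apply/seteqP; split=> y /= h.
  exact: path_joined_trans dx (path_joined_trans (path_joined_sym cx) h).
exact: path_joined_trans cx (path_joined_trans (path_joined_sym dx) h).
Qed.

End path_lemmas.

Section ends_equivalence.
Context {R : realType} (Z : metricType R).

Lemma ends_equiv_refl (r : halfline R -> Z) : end_rays Z r -> ends_equiv r r.
Proof.
move=> [cr pr] B /pr/halfline_bounded[M BM].
have M0 : 0 < `|M| + 1 by rewrite ltr_wpDl.
have rB (s : halfline R) : `|M| + 1 <= hval s -> (~` B) (r s).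
  move=> Ms /(BM s) sM; have := ler_norm M; lra.
pose t : halfline R := hl (`|M| + 1).
have tE : hval t = `|M| + 1 by apply: val_hl; exact: ltW.
exists t, [set y | path_joined (R := R) (~` B) (r t) y].
  by exists (r t) => //; apply: rB; rewrite tE.
suff h : tail r t `<=` [set y | path_joined (R := R) (~` B) (r t) y] by [].
move=> _ [s /= ts <-]; rewrite tE in ts.
have vE (u : R) : 0 <= u -> u <= 1 -> let v := `|M| + 1 + u * (hval s - (`|M| + 1)) in
    `|M| + 1 <= v.
  by move=> u0 u1 /=; rewrite lerDl mulr_ge0// subr_ge0.
exists (fun u : R => r (hl (`|M| + 1 + u * (hval s - (`|M| + 1))))); split.
- apply: continuous_subspaceT => u; apply: continuous_comp; last exact: cr.
  apply: continuous_comp; last exact: hl_continuous.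
  apply: continuousD; first exact: cst_continuous.
  by apply: continuousM; [exact: cvg_id|exact: cst_continuous].
- by rewrite mul0r addr0.
- congr r; apply: val_inj; rewrite mul1r subrKC.
  by apply: val_hl; exact: halfline_ge0.
- move=> _ [u /= + <-]; rewrite in_itv/= => /andP[u0 u1]; apply: rB.
  have := vE _ u0 u1; cbv zeta => h.
  by rewrite val_hl// (le_trans _ h)// ltW.
Qed.

Lemma ends_equiv_sym (r r' : halfline R -> Z) :
  ends_equiv r r' -> ends_equiv r' r.
Proof.
by move=> h B /h[t [C CB [rC r'C]]]; exists t, C.
Qed.

Lemma ends_equiv_trans (r' r r'' : halfline R -> Z) :
  ends_equiv r r' -> ends_equiv r' r'' -> ends_equiv r r''.
Proof.
move=> h h' B bB; have [t [C CB [rC r'C]]] := h B bB.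
have [t' [C' CB' [r'C' r''C']]] := h' B bB.
have tailS (f : halfline R -> Z) (a b : halfline R) :
    hval a <= hval b -> tail f b `<=` tail f a.
  by move=> ab _ [s /= bs <-]; exists s => //=; exact: le_trans ab bs.
pose m := hl (Num.max (hval t) (hval t')).
have mE : hval m = Num.max (hval t) (hval t').
  by apply: val_hl; rewrite le_max halfline_ge0.
have tm : hval t <= hval m by rewrite mE le_max lexx.
have t'm : hval t' <= hval m by rewrite mE le_max lexx orbT.
have r'm : tail r' m (r' m) by exists m => /=.
have CC' : C = C'.
  apply: (is_path_component_eq CB CB' (x := r' m)).
    exact: r'C (tailS _ _ _ tm _ r'm).
  exact: r'C' (tailS _ _ _ t'm _ r'm).
exists m, C => //; split; first exact: subset_trans (tailS _ _ _ tm) rC.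
by rewrite CC'; exact: subset_trans (tailS _ _ _ t'm) r''C'.
Qed.

End ends_equivalence.

Section coarse_homotopy_equivalence.
Context {R : realType} {Z Y : metricType R}.
Implicit Types (q : Z -> halfline R) (f g : Z -> Y).

Definition clamp q (z : Z) (t : R) : R := Num.min (Num.max 0 t) (hval (q z)).

Lemma clamp_ge0 q z t : 0 <= clamp q z t.
Proof. by rewrite /clamp le_min le_max lexx halfline_ge0. Qed.

Lemma mk_cyl_subproof q z t : (z, hl (clamp q z t)) \in cylinder q.
Proof.
apply: mem_set; rewrite /cylinder/= val_hl ?clamp_ge0//.
by rewrite /clamp ge_min lexx orbT.
Qed.

Definition mk_cyl q z t : cylinder q := SigSub (mk_cyl_subproof q z t).

Lemma cyl_time_ge0 q (p : cylinder q) : 0 <= cyl_time p.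
Proof. exact: halfline_ge0. Qed.

Lemma cyl_time_le q (p : cylinder q) : cyl_time p <= hval (q (cyl_pt p)).
Proof. by have := set_valP p. Qed.

Lemma cyl_pt_mk q z t : cyl_pt (mk_cyl q z t) = z. Proof. by []. Qed.

Lemma cyl_time_mk q z t : cyl_time (mk_cyl q z t) = clamp q z t.
Proof. by rewrite /cyl_time /= val_hl// clamp_ge0. Qed.

Lemma cyl_dist q (p p' : cylinder q) : mdist p p' =
  Num.max (mdist (cyl_pt p) (cyl_pt p')) `|cyl_time p' - cyl_time p|.
Proof. by []. Qed.

Lemma mk_cyl_dist q z z' (t t' : R) (d : R) : mdist z z' < d ->
  `|hval (q z') - hval (q z)| < d -> `|t' - t| < d ->
  mdist (mk_cyl q z t) (mk_cyl q z' t') < d.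
Proof.
move=> zz' qq' tt'; rewrite cyl_dist !cyl_time_mk gt_max cyl_pt_mk zz'/=.
move: qq' tt'; rewrite /clamp !ltr_norml => /andP[? ?] /andP[? ?].
rewrite !minEle !maxEle.
by do !case: ifPn; rewrite -?ltNge => *; apply/andP; split; lra.
Qed.

Lemma cyl_bounded q (A : set (cylinder q)) : controlled q ->
  mbounded (@cyl_pt R Z q @` A) -> mbounded A.
Proof.
move=> cq bA; have /halfline_bounded[M qM] := controlled_bounded cq bA.
move: bA => [N AN]; exists (Num.max N M) => p p' Ap Ap'.
have tM (r : cylinder q) : A r -> cyl_time r <= M.
  move=> Ar; apply: le_trans (cyl_time_le r) (qM _ _).
  by exists (cyl_pt r) => //; exists r.
rewrite cyl_dist ge_max; apply/andP; split; rewrite le_max.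
  by apply/orP; left; apply: AN; [exists p|exists p'].
apply/orP; right; rewrite ler_norml.
have := tM _ Ap; have := tM _ Ap'.
have := cyl_time_ge0 p; have := cyl_time_ge0 p'.
by move=> *; apply/andP; split; lra.
Qed.

Lemma cyl_pt_bounded q (A : set (cylinder q)) :
  mbounded A -> mbounded (@cyl_pt R Z q @` A).
Proof.
move=> [M AM]; exists M => _ _ [p Ap <-] [p' Ap' <-].
by have := AM _ _ Ap Ap'; rewrite cyl_dist ge_max => /andP[].
Qed.

Lemma exists_coarse_halfline : exists q : Z -> halfline R, coarse q.
Proof.
have [[z0 _]|Z0] := pselect (exists z0 : Z, True); last first.
  exists (fun=> hl 0); split; last first.
    by move=> B _; exists 0 => z; exfalso; apply: Z0; exists z.
  by move=> r r0; exists 1 => // z; exfalso; apply: Z0; exists z.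
have hq z : hval (hl (mdist z0 z)) = mdist z0 z by apply: val_hl; exact: mdist_ge0.
exists (fun z => hl (mdist z0 z)); split.
  move=> r r0; exists r => // z z' zz'; rewrite halfline_dist !hq ltr_norml.
  have := metric_triangle z0 z z'; have := metric_triangle z0 z' z.
  by rewrite (metric_sym z' z) => ? ?; apply/andP; split; lra.
move=> B /halfline_bounded[M BM]; exists (M + M) => z z' /BM + /BM.
rewrite !hq => ? ?; have := metric_triangle z z0 z'; rewrite (metric_sym z z0).
lra.
Qed.

Lemma coarse_homotopic_refl f : coarse f -> coarse_homotopic f f.
Proof.
move=> [cf pf]; have [q [cq pq]] := exists_coarse_halfline.
exists q, (fun p => f (cyl_pt p)); split => //; split.
  move=> r /cf[s s0 fs]; exists s => // p p'.
  by rewrite cyl_dist gt_max => /andP[/fs].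
move=> B /pf fB; apply: cyl_bounded => //; apply: mbounded_sub fB.
by move=> _ [p /= Bp <-].
Qed.

Lemma coarse_homotopic_sym f g : coarse_homotopic f g -> coarse_homotopic g f.
Proof.
move=> [q [H [[cq pq] [cH pH] H0 H1]]].
pose rv (p : cylinder q) : cylinder q :=
  mk_cyl q (cyl_pt p) (hval (q (cyl_pt p)) - cyl_time p).
have rvt p : cyl_time (rv p) = hval (q (cyl_pt p)) - cyl_time p.
  rewrite cyl_time_mk /clamp max_r ?subr_ge0 ?cyl_time_le// min_l//.
  by rewrite gerBl cyl_time_ge0.
exists q, (fun p => H (rv p)); split => //; last first.
- by move=> p pE; rewrite H0 ?rvt ?pE ?subrr.
- by move=> p pE; rewrite H1 ?rvt ?pE ?subr0.
split.
  move=> r r0; have [s s0 qs] := cq _ r0.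
  have [S S0 HS] := cH _ (addr_gt0 r0 s0); exists S => // p p' pp'.
  apply: HS; move: pp'; rewrite cyl_dist gt_max => /andP[zz' tt'].
  have := qs _ _ zz'; rewrite halfline_dist => qq'.
  apply: mk_cyl_dist; [lra|lra|].
  move: qq' tt'; rewrite !ltr_norml => /andP[? ?] /andP[? ?].
  by apply/andP; split; lra.
move=> B /pH/cyl_pt_bounded HB; apply: cyl_bounded => //.
by apply: mbounded_sub HB => _ [p /= Bp <-]; exists (rv p).
Qed.

Lemma coarse_homotopic_trans g f k : coarse g ->
  coarse_homotopic f g -> coarse_homotopic g k -> coarse_homotopic f k.
Proof.
move=> [cg _] [q1 [H1 [[cq1 pq1] [cH1 pH1] H10 H11]]].
move=> [q2 [H2 [[cq2 pq2] [cH2 pH2] H20 H21]]].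
pose q z := hl (hval (q1 z) + hval (q2 z)).
have qE z : hval (q z) = hval (q1 z) + hval (q2 z).
  by apply: val_hl; rewrite addr_ge0// halfline_ge0.
have cq : controlled q.
  move=> r r0; have [s1 s10 h1] := cq1 _ r0; have [s2 s20 h2] := cq2 _ r0.
  exists (s1 + s2) => [|z z' zz']; first exact: addr_gt0.
  have := h1 _ _ zz'; have := h2 _ _ zz'; rewrite !halfline_dist !qE !ltr_norml.
  by move=> /andP[? ?] /andP[? ?]; apply/andP; split; lra.
pose a (p : cylinder q) := mk_cyl q1 (cyl_pt p) (cyl_time p).
pose b (p : cylinder q) :=
  mk_cyl q2 (cyl_pt p) (cyl_time p - hval (q1 (cyl_pt p))).
have at_le p : cyl_time p <= hval (q1 (cyl_pt p)) -> cyl_time (a p) = cyl_time p.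
  by move=> h; rewrite cyl_time_mk /clamp max_r ?cyl_time_ge0// min_l.
have at_gt p : hval (q1 (cyl_pt p)) < cyl_time p -> H1 (a p) = g (cyl_pt p).
  move=> /ltW h; rewrite H11// cyl_time_mk /clamp max_r ?cyl_time_ge0//.
  by rewrite min_r.
have bt_le p : cyl_time p <= hval (q1 (cyl_pt p)) -> H2 (b p) = g (cyl_pt p).
  move=> h; rewrite H20// cyl_time_mk /clamp max_l ?subr_le0// min_l//.
  exact: halfline_ge0.
have bt_gt p : hval (q1 (cyl_pt p)) < cyl_time p ->
    cyl_time (b p) = cyl_time p - hval (q1 (cyl_pt p)).
  move=> /ltW h; rewrite cyl_time_mk /clamp max_r ?subr_ge0// min_l//.
  by rewrite lerBlDl -qE cyl_time_le.
pose H (p : cylinder q) : Y :=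
  if cyl_time p <= hval (q1 (cyl_pt p)) then H1 (a p) else H2 (b p).
exists q, H; split; last first.
- move=> p pE; rewrite /H; case: ifPn => [h|]; last first.
    by rewrite -ltNge => h; rewrite H21// bt_gt// pE qE addrC addKr.
  have q20 : hval (q2 (cyl_pt p)) = 0.
    apply/le_anti; rewrite halfline_ge0 andbT.
    by move: h; rewrite pE qE gerDl.
  have <- : g (cyl_pt p) = k (cyl_pt p).
    rewrite -(H20 (mk_cyl q2 (cyl_pt p) 0)) ?H21// cyl_time_mk /clamp maxxx.
      by rewrite q20 minxx.
    by rewrite q20 minxx.
  by rewrite H11// at_le// pE qE q20 addr0.
- move=> p p0; rewrite /H p0 halfline_ge0 H10// at_le//.
  by rewrite p0 halfline_ge0.
- split.
    move=> r r0; have [s s0 q1s] := cq1 _ r0; have [s' s'0 q2s'] := cq2 _ r0.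
    have rs : 0 < r + s + s' by rewrite !addr_gt0.
    have [S1 S10 h1] := cH1 _ rs; have [S2 S20 h2] := cH2 _ rs.
    have [Sg Sg0 hg] := cg _ r0.
    exists (S1 + Sg + S2) => [|p p']; first by rewrite !addr_gt0.
    rewrite cyl_dist gt_max => /andP[zz' tt'].
    have := q1s _ _ zz'; have := q2s' _ _ zz'; rewrite !halfline_dist => Q2 Q1.
    have aa' : mdist (H1 (a p)) (H1 (a p')) < S1.
      by apply: h1; apply: mk_cyl_dist; lra.
    have bb' : mdist (H2 (b p)) (H2 (b p')) < S2.
      apply: h2; apply: mk_cyl_dist; [lra|lra|].
      move: Q1 tt'; rewrite !ltr_norml => /andP[? ?] /andP[? ?].
      by apply/andP; split; lra.
    have gg' := hg _ _ zz'.
    rewrite /H; case: ifPn => [h|]; last rewrite -ltNge => h.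
      case: ifPn => [_|]; last rewrite -ltNge => h'; first lra.
      have := metric_triangle (H1 (a p)) (H1 (a p')) (H2 (b p')).
      have := metric_triangle (H1 (a p')) (H2 (b p)) (H2 (b p')).
      have : mdist (H1 (a p')) (H2 (b p)) < Sg.
        by rewrite at_gt// bt_le// metric_sym.
      lra.
    case: ifPn => [h'|_]; last lra.
    have := metric_triangle (H2 (b p)) (H2 (b p')) (H1 (a p')).
    have := metric_triangle (H2 (b p')) (H1 (a p)) (H1 (a p')).
    have : mdist (H2 (b p')) (H1 (a p)) < Sg.
      by rewrite at_gt// bt_le// metric_sym.
    lra.
  move=> B bB; apply: cyl_bounded => //.
  have := mbounded_setU (cyl_pt_bounded (pH1 _ bB)) (cyl_pt_bounded (pH2 _ bB)).
  apply: mbounded_sub => _ [p /= + <-]; rewrite /H; case: ifPn => _ Bp.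
    by left; exists (a p).
  by right; exists (b p).
- split=> // B /halfline_bounded[M BM]; apply: (@mbounded_sub _ _ _
    (q1 @^-1` [set t | hval t <= M])).
    move=> z /BM; rewrite qE /= => h; apply: le_trans h.
    by rewrite lerDl halfline_ge0.
  by apply: pq1; apply/halfline_bounded; exists M.
Qed.

End coarse_homotopy_equivalence.

Section ends_quotient.
Context {R : realType} (Z : metricType R).
Local Open Scope quotient_scope.

Definition ends_rel (r r' : end_rays Z) : bool :=
  `[< ends_equiv (\val r) (\val r') >].

Lemma ends_rel_refl : reflexive ends_rel.
Proof. by move=> r; apply/asboolP/ends_equiv_refl; have := set_valP r. Qed.

Lemma ends_rel_sym : symmetric ends_rel.
Proof.
by move=> r r'; apply/asboolP/asboolP; exact: ends_equiv_sym.
Qed.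

Lemma ends_rel_trans : transitive ends_rel.
Proof.
move=> r' r r'' /asboolP h /asboolP h'; apply/asboolP.
exact: ends_equiv_trans h h'.
Qed.

Canonical ends_equivRel := EquivRel ends_rel
  ends_rel_refl ends_rel_sym ends_rel_trans.

Definition Ends : Type := {eq_quot ends_rel}.

End ends_quotient.

Definition coarse_rays {R : realType} (Z : metricType R) : set (halfline R -> Z) :=
  [set r | coarse r].
Arguments coarse_rays {R} Z.

Section pi0_coarse.
Context {R : realType} (Z : metricType R).
Local Open Scope quotient_scope.

Definition pi0_rel (r r' : coarse_rays Z) : bool :=
  `[< coarse_homotopic (\val r) (\val r') >].

Lemma pi0_rel_refl : reflexive pi0_rel.
Proof. by move=> r; apply/asboolP/coarse_homotopic_refl; have := set_valP r. Qed.

Lemma pi0_rel_sym : symmetric pi0_rel.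
Proof.
by move=> r r'; apply/asboolP/asboolP; exact: coarse_homotopic_sym.
Qed.

Lemma pi0_rel_trans : transitive pi0_rel.
Proof.
move=> r' r r'' /asboolP h /asboolP h'; apply/asboolP.
by apply: coarse_homotopic_trans h h'; have := set_valP r'.
Qed.

Canonical pi0_equivRel := EquivRel pi0_rel pi0_rel_refl pi0_rel_sym pi0_rel_trans.

Definition pi0_crs : Type := {eq_quot pi0_rel}.

End pi0_coarse.

(* Abstract simplicial complexes; elements of V that lie in no face are
   harmless, as they do not contribute to the realization. *)
Record simplicial_complex (V : finType) := SimplicialComplex {
  faces : {set {set V}};
  faces_neq0 : finset.set0 \notin faces;
  faces_subset : forall s t : {set V},
    s \in faces -> t \subset s -> t != finset.set0 -> t \in faces
}.

(* Points of the realization are given by their barycentric coordinates. *)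
Definition realization (R : realType) (V : finType) (K : simplicial_complex V) :
    set {ptws V -> R} :=
  [set b | [/\ forall v, 0 <= b v, \sum_v b v = 1 &
               [set v | 0 < b v]%SET \in faces K]].
Arguments realization R {V} K.

Definition in_simplex (R : realType) (V : finType) (s : {set V}) (b : V -> R) : Prop :=
  forall v, v \notin s -> b v = 0.

Definition linear_on_simplices (R : realType) (V : finType) (n : nat)
    (K : simplicial_complex V) (phi : realization R K -> euclidean R n) : Prop :=
  forall s : {set V}, s \in faces K -> exists a : V -> euclidean R n,
    forall b : realization R K, in_simplex s (\val b) ->
      phi b = \sum_(v in s) (\val b : V -> R) v *: a v.

Definition topological_embedding (S T : topologicalType) (phi : S -> T) : Prop :=
  [/\ injective phi, continuous phi &
      forall U : set S, open U ->
        exists2 W : set T, open W & phi @` U = W `&` range phi].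

Definition geometric_simplicial_complex (R : realType) (n : nat)
    (X : set (euclidean R n)) : Prop :=
  exists (V : finType) (K : simplicial_complex V)
         (phi : realization R K -> euclidean R n),
    [/\ topological_embedding phi, linear_on_simplices phi & X = range phi].

(* The last coordinate is the height. *)
Definition cone (R : realType) (n : nat) (X : set (euclidean R n)) :
    set (euclidean R (n + 1)) :=
  [set p | exists h x, [/\ 0 <= h, X x & p = row_mx (h *: x) (const_mx h)]].

(* Main.v *)
(* In barycentric coordinates a point of the cone is a weight function on the
   vertices whose support is a face or empty. The Euclidean metric is
   bi-Lipschitz to the l1 metric on weights: differences of weights of l1 norm 1
   form a compact set, on which the map to Euclidean space does not vanish
   because the realization is embedded. Ends and coarse classes of rays are both
   classified by the component of the complex in which the ray ends up.

   A path away from the apex cannot change component, and neither can a coarse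
   ray or a coarse homotopy of rays, since far out two points at bounded distance
   have a vertex in common. Conversely, points far out in the same component are
   joined by paths along edges at constant height. A coarse ray [r] is slowed
   down to [r (sqrt t)], then moved in straight lines to a walk along edges at
   height [sqrt t]. The walk can be traced back to its first vertex in time [t],
   which leaves a straight ray. *)

Require Import Defs.
From mathcomp Require Import all_boot all_order all_algebra generic_quotient.
From mathcomp Require Import all_classical all_reals all_analysis.
From mathcomp Require Import ring lra.

Set Implicit Arguments.
Unset Strict Implicit.
Unset Printing Implicit Defensive.

Import Order.TTheory GRing.Theory Num.Theory.
Import numFieldNormedType.Exports.

Local Open Scope classical_set_scope.
Local Open Scope ring_scope.

(** * Weights on the vertices *)

Section weights.
Context {R : realType} {V : finType}.
Implicit Types w x y : V -> R.

Definition mass w : R := \sum_v w v.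

Definition l1 x y : R := \sum_v `|x v - y v|.

Definition supp w : {set V} := [set v | 0 < w v]%SET.

Definition admissible (F : {set {set V}}) w : Prop :=
  (forall v, 0 <= w v) /\ supp w \in F.

Definition vertex (v : V) : V -> R := fun u => (u == v)%:R.

Lemma l1_ge0 x y : 0 <= l1 x y.
Proof. by apply: sumr_ge0. Qed.

Lemma l1_sym x y : l1 x y = l1 y x.
Proof. by apply: eq_bigr => v _; rewrite distrC. Qed.

Lemma l1xx x : l1 x x = 0.
Proof. by apply: big1 => v _; rewrite subrr normr0. Qed.

Lemma l1_triangle y x z : l1 x z <= l1 x y + l1 y z.
Proof. by rewrite -big_split; apply: ler_sum => v _; exact: ler_distD. Qed.

Lemma mass_l1 x y : `|mass x - mass y| <= l1 x y.
Proof. by rewrite /mass -sumrB; exact: ler_norm_sum. Qed.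

Lemma mass_ge0 w : (forall v, 0 <= w v) -> 0 <= mass w.
Proof. by move=> w0; apply: sumr_ge0. Qed.

Lemma l1_le_mass x y : (forall v, 0 <= x v) -> (forall v, 0 <= y v) ->
  l1 x y <= mass x + mass y.
Proof.
move=> x0 y0; rewrite -big_split; apply: ler_sum => v _ /=.
by rewrite (le_trans (ler_normB _ _))// !ger0_norm.
Qed.

Lemma l1_lin (a b : R) w : (forall v, 0 <= w v) ->
  l1 (fun v => a * w v) (fun v => b * w v) = `|a - b| * mass w.
Proof.
move=> w0; rewrite /mass mulr_sumr; apply: eq_bigr => v _.
by rewrite -mulrBl normrM [`|w v|]ger0_norm.
Qed.

Lemma l1_scale (a : R) x y :
  l1 (fun v => a * x v) (fun v => a * y v) = `|a| * l1 x y.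
Proof.
by rewrite mulr_sumr; apply: eq_bigr => v _; rewrite -mulrBr normrM.
Qed.

Lemma l1D x y x' y' :
  l1 (fun v => x v + y v) (fun v => x' v + y' v) <= l1 x x' + l1 y y'.
Proof.
rewrite -big_split; apply: ler_sum => v _ /=.
by rewrite opprD addrACA ler_normD.
Qed.

Lemma massD x y : mass (fun v => x v + y v) = mass x + mass y.
Proof. by rewrite /mass big_split. Qed.

Lemma massZ (a : R) x : mass (fun v => a * x v) = a * mass x.
Proof. by rewrite /mass mulr_sumr. Qed.

Lemma mass_vertex (v : V) : mass (vertex v) = 1.
Proof.
rewrite /mass (bigD1 v)//= /vertex eqxx big1 ?addr0// => u uv.
by rewrite (negbTE uv).
Qed.

Lemma vertex_ge0 (v u : V) : 0 <= vertex v u.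
Proof. exact: ler0n. Qed.

Lemma mem_supp w v : (v \in supp w) = (0 < w v).
Proof. by rewrite inE. Qed.

Lemma supp_vertex (v : V) : supp (vertex v) = [set v]%SET.
Proof. by apply/setP => u; rewrite !inE /vertex ltr0n lt0b. Qed.

Lemma suppZ (a : R) w : 0 < a -> supp (fun v => a * w v) = supp w.
Proof. by move=> a0; apply/setP => u; rewrite !inE pmulr_rgt0. Qed.

Lemma supp_conv (a b : R) x y : 0 <= a -> 0 <= b ->
    (forall v, 0 <= x v) -> (forall v, 0 <= y v) ->
  supp (fun v => a * x v + b * y v) \subset supp x :|: supp y.
Proof.
move=> a0 b0 x0 y0; apply/fintype.subsetP => v; rewrite !inE => h.
have := x0 v; rewrite le_eqVlt => /orP[/eqP xv|->//].
have := y0 v; rewrite le_eqVlt => /orP[/eqP yv|->//]; last by rewrite orbT.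
by move: h; rewrite -xv -yv !mulr0 addr0 ltxx.
Qed.

Lemma mass_gt0P w : (forall v, 0 <= w v) -> 0 < mass w ->
  exists v, v \in supp w.
Proof.
move=> w0 m0; apply: contrapT => h; move: m0; rewrite /mass big1 ?ltxx// => v _.
apply/le_anti; rewrite w0 andbT leNgt; apply/negP => wv.
by apply: h; exists v; rewrite inE.
Qed.

Lemma supp_mass_gt0 w v : (forall v, 0 <= w v) -> v \in supp w -> 0 < mass w.
Proof.
move=> w0; rewrite inE => wv; rewrite /mass (bigD1 v)//= ltr_wpDr//.
by apply: sumr_ge0.
Qed.

(** If the supports were disjoint, no cancellation would occur and [l1 x y] would be the full
    [mass x + mass y]. *)
Lemma supp_meet x y : (forall v, 0 <= x v) -> (forall v, 0 <= y v) ->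
  l1 x y < mass x -> exists v, v \in supp x :&: supp y.
Proof.
move=> x0 y0 h; apply: contrapT => h'.
suff : l1 x y = mass x + mass y.
  by move=> E; move: h; rewrite E ltNge lerDl mass_ge0.
rewrite /mass -big_split; apply: eq_bigr => v _ /=.
have := x0 v; rewrite le_eqVlt => /orP[/eqP <-|xv].
  by rewrite sub0r normrN add0r ger0_norm.
have := y0 v; rewrite le_eqVlt => /orP[/eqP <-|yv].
  by rewrite addr0 subr0 ger0_norm.
by exfalso; apply: h'; exists v; rewrite !inE xv yv.
Qed.

(** The mass is a sum of [#|V|] weights, none above the largest one. *)
Lemma heavy_vertex w : (forall v, 0 <= w v) -> 0 < mass w ->
  exists v, mass w <= #|V|%:R * w v.
Proof.
move=> w0 m0; have [v0 _] := mass_gt0P w0 m0.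
pose v := [arg max_(v > v0) w v]%O.
exists v; rewrite /mass mulr_natl -sumr_const; apply: ler_sum => u _.
by rewrite /v; case: arg_maxP => // i _; apply.
Qed.

Lemma l1_coord x y v : x v - y v <= l1 x y.
Proof.
apply: le_trans (ler_norm _) _.
by rewrite /l1 (bigD1 v)//= lerDl sumr_ge0.
Qed.

End weights.

(** * Coarse homotopies in coordinates *)

(* [F] consists of the faces together with the empty set, the support of the
   apex. The height is the total mass. *)
Record cone_chart (R : realType) (V : finType) (Z : metricType R)
    (F : {set {set V}}) (W : Z -> V -> R) (C : R) : Prop := ConeChart {
  chart_cst : 0 < C;
  chart_face : forall s t : {set V}, s \in F -> t \subset s -> t \in F;
  chart_adm : forall z, admissible F (W z);
  chart_surj : forall w, admissible F w -> exists z, W z = w;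
  chart_dist : forall z z', mdist z z' <= C * l1 (W z) (W z');
  chart_l1 : forall z z', l1 (W z) (W z') <= C * mdist z z'
}.

Section chart.
Context {R : realType} {V : finType} {Z : metricType R}.
Context {F : {set {set V}}} {W : Z -> V -> R} {C : R} (ch : cone_chart F W C).
Implicit Types (z : Z) (v : V) (r f g : halfline R -> Z).

Lemma chart_ge0 z v : 0 <= W z v.
Proof. by have [] := chart_adm ch z. Qed.
Local Hint Resolve chart_ge0 : core.

Lemma chart_supp z : supp (W z) \in F.
Proof. by have [] := chart_adm ch z. Qed.

Lemma chart_inj z z' : W z = W z' -> z = z'.
Proof.
move=> zz'; apply: mdist_positivity; apply/le_anti.
by rewrite mdist_ge0 andbT (le_trans (chart_dist ch _ _))// zz' l1xx mulr0.
Qed.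

Lemma chart_lift (T : Type) (h : T -> V -> R) : (forall x, admissible F (h x)) ->
  exists H : T -> Z, forall x, W (H x) = h x.
Proof.
move=> hF; have /boolp.choice[H HE] : forall x, exists z, W z = h x.
  by move=> x; exact: (chart_surj ch (hF x)).
by exists H.
Qed.

(** The mass is the [l1] distance to the zero weight, so bounded sets are those at bounded height
    above the apex. *)
Lemma bounded_massP (A : set Z) :
  mbounded A <-> exists M : R, forall z, A z -> mass (W z) <= M.
Proof.
have C0 := chart_cst ch.
split=> [[M AM]|[M AM]].
  have [->|/set0P[a Aa]] := eqVneq A set0; first by exists 0.
  exists (mass (W a) + C * M) => z Az.
  have := mass_l1 (W z) (W a); have := chart_l1 ch z a.
  have := AM _ _ Az Aa; rewrite -(ler_pM2l C0) ler_norml => h1 h2 /andP[? ?].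
  lra.
exists (C * (M + M)) => x y Ax Ay; rewrite (le_trans (chart_dist ch _ _))//.
rewrite ler_pM2l// (le_trans (l1_le_mass _ _))//; apply: lerD; exact: AM.
Qed.

Lemma controlled_l1P (T : metricType R) (f : T -> Z) : controlled f <->
  forall d : R, 0 < d -> exists s : R, forall x y, mdist x y < d ->
    l1 (W (f x)) (W (f y)) <= s.
Proof.
have C0 := chart_cst ch.
split=> cf d d0.
  have [s s0 fs] := cf _ d0; exists (C * s) => x y /fs xy.
  by rewrite (le_trans (chart_l1 ch _ _))// ler_pM2l// ltW.
have [s fs] := cf _ d0; exists (C * `|s| + 1) => [|x y /fs xy].
  by rewrite ltr_wpDl// mulr_ge0// ltW.
rewrite (le_lt_trans (chart_dist ch _ _))// ltr_pwDr// ler_pM2l//.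
exact: le_trans (ler_norm _).
Qed.

Lemma proper_massP (T : metricType R) (f : T -> Z) : metrically_proper f <->
  forall M : R, mbounded [set x | mass (W (f x)) <= M].
Proof.
split=> [pf M|pf B /bounded_massP[M BM]].
  by apply: (pf [set z | mass (W z) <= M]); apply/bounded_massP; exists M.
by apply: mbounded_sub (pf M) => x /BM.
Qed.

Lemma proper_rayP r : metrically_proper r <->
  forall M : R, exists N : R, forall t, mass (W (r t)) <= M -> hval t <= N.
Proof.
split=> [/proper_massP pr M|pr]; first exact/halfline_bounded/pr.
by apply/proper_massP => M; exact/halfline_bounded/pr.
Qed.

Lemma coarse_rayP r : coarse r <->
  (forall d : R, 0 < d -> exists s : R, forall t t',
     `|hval t - hval t'| < d -> l1 (W (r t)) (W (r t')) <= s) /\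
  (forall M : R, exists N : R, forall t, mass (W (r t)) <= M -> hval t <= N).
Proof.
split=> [[/controlled_l1P cr /proper_rayP pr]|[cr pr]]; split => //.
- move=> d /cr[s rs]; exists s => t t' tt'.
  by apply: rs; rewrite halfline_dist distrC.
- apply/controlled_l1P => d /cr[s rs]; exists s => t t'.
  by rewrite halfline_dist distrC; exact: rs.
- exact/proper_rayP.
Qed.

Lemma coarse_halflineP (q : halfline R -> halfline R) :
  (forall d : R, 0 < d -> exists s : R, forall t t',
     `|hval t - hval t'| < d -> `|hval (q t) - hval (q t')| <= s) ->
  (forall M : R, exists N : R, forall t, hval (q t) <= M -> hval t <= N) ->
  coarse q.
Proof.
move=> cq pq; split.
  move=> d /cq[s qs]; exists (`|s| + 1) => [|t t' tt']; first by rewrite ltr_wpDl.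
  rewrite halfline_dist distrC ltr_pwDr//; apply: le_trans (ler_norm _).
  by apply: qs; rewrite distrC -halfline_dist.
move=> B /halfline_bounded[M BM]; apply/halfline_bounded.
by have [N qN] := pq M; exists N => t /BM /qN.
Qed.

(** Lets a homotopy be given by a formula in weights, of which only the values at
    [0 <= s <= hval (q t)] matter. For properness a bound on [t] suffices, because the time is
    bounded by the controlled [q]. *)
Lemma coarse_homotopic_weights f g (q : halfline R -> halfline R)
    (h : halfline R -> R -> V -> R) : coarse q ->
  (forall t s, 0 <= s <= hval (q t) -> admissible F (h t s)) ->
  (forall d : R, 0 < d -> exists e : R, forall t t' s s',
     0 <= s <= hval (q t) -> 0 <= s' <= hval (q t') ->
     `|hval t - hval t'| < d -> `|s - s'| < d -> l1 (h t s) (h t' s') <= e) ->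
  (forall M : R, exists N : R, forall t s,
     0 <= s <= hval (q t) -> mass (h t s) <= M -> hval t <= N) ->
  (forall t, h t 0 = W (f t)) -> (forall t, h t (hval (q t)) = W (g t)) ->
  coarse_homotopic f g.
Proof.
move=> cq hF ch' ph h0 h1.
have time (p : cylinder q) : 0 <= cyl_time p <= hval (q (cyl_pt p)).
  by rewrite cyl_time_ge0 cyl_time_le.
have [H HE] := @chart_lift (cylinder q) (fun p => h (cyl_pt p) (cyl_time p))
  (fun p => hF _ _ (time p)).
exists q, H; split => //; last 2 first.
- by move=> p p0; apply: chart_inj; rewrite HE p0 h0.
- by move=> p p1; apply: chart_inj; rewrite HE p1 h1.
split.
  apply/controlled_l1P => d /ch'[e he]; exists e => p p'.
  rewrite cyl_dist gt_max => /andP[pp' tt']; rewrite !HE.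
  by apply: he => //; rewrite distrC// -halfline_dist.
apply/proper_massP => M; apply: cyl_bounded; first by case: cq.
apply/halfline_bounded; have [N hN] := ph M; exists N => _ [p /= + <-].
by rewrite HE; exact: hN.
Qed.

(* Moving the parameter monotonically from [t] to [phi t]. *)
Lemma coarse_homotopic_reparam r (phi : halfline R -> halfline R) :
  coarse r -> coarse phi -> coarse_homotopic r (r \o phi).
Proof.
move=> /coarse_rayP[cr pr] [cphi pphi].
pose q (t : halfline R) := hl (hval t + hval (phi t)).
have qE t : hval (q t) = hval t + hval (phi t).
  by rewrite val_hl// addr_ge0// halfline_ge0.
(* For [s >= 0] this moves from [t] towards [phi t] at unit speed, in either direction, and stops
   there. The time [q t] is enough, as the distance is at most the sum of the two. *)
pose pos (t : halfline R) (s : R) :=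
  Num.max (hval t - s) (Num.min (hval t + s) (hval (phi t))).
have pos_ge t s : 0 <= s -> Num.min (hval t) (hval (phi t)) <= pos t s.
  move=> s0; rewrite /pos !maxEle !minEle.
  by do !case: ifPn; rewrite -?ltNge => *; lra.
have pos0 t s : 0 <= s -> 0 <= pos t s.
  by move=> /(pos_ge t); apply: le_trans; rewrite le_min !halfline_ge0.
have phid d : 0 < d -> exists2 e : R, 0 < e & forall t t',
    `|hval t - hval t'| < d -> `|hval (phi t) - hval (phi t')| < e.
  move=> /cphi[e e0 phie]; exists e => // t t' tt'.
  by rewrite -halfline_dist metric_sym; apply: phie; rewrite halfline_dist distrC.
apply: (coarse_homotopic_weights (q := q) (h := fun t s => W (r (hl (pos t s))))).
- apply: coarse_halflineP.
    move=> d d0; have [e e0 phie] := phid _ d0; exists (d + e) => t t' tt'.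
    rewrite !qE opprD addrACA (le_trans (ler_normD _ _))// lerD ?ltW//.
    exact: phie.
  by move=> M; exists M => t; rewrite qE; have := halfline_ge0 (phi t); lra.
- by move=> t s _; exact: (chart_adm ch _).
- move=> d d0; have [e e0 phie] := phid _ d0.
  have [S rS] := cr _ (addr_gt0 (addr_gt0 d0 d0) e0).
  exists S => t t' s s' /andP[s0 _] /andP[s'0 _] tt' ss'.
  apply: rS; rewrite !val_hl ?pos0//.
  move: tt' ss' (phie _ _ tt'); rewrite !ltr_norml.
  move=> /andP[? ?] /andP[? ?] /andP[? ?]; rewrite /pos !maxEle !minEle.
  by do !case: ifPn; rewrite -?ltNge => *; apply/andP; split; lra.
- move=> M; have [N rN] := pr M.
  have /halfline_bounded[N' phiN] :
    mbounded (phi @^-1` [set t | hval t <= N]).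
    by apply: pphi; apply/halfline_bounded; exists N.
  (* The position never falls below the smaller of [t] and [phi t], so one of the two is at most
     [N]. *)
  exists (Num.max N N') => t s /andP[s0 _] /rN.
  rewrite val_hl ?pos0// => /(le_trans (pos_ge t _ s0)).
  rewrite ge_min le_max => /orP[->//|/phiN ->].
  by rewrite orbT.
- move=> t; congr (W (r _)); apply: val_inj; rewrite /= /pos subr0 addr0.
  rewrite ger0_norm; last by rewrite le_max halfline_ge0.
  by rewrite max_l// ge_min lexx.
- move=> t; congr (W (r _)); apply: val_inj; rewrite /= qE /pos.
  have := halfline_ge0 t; have := halfline_ge0 (phi t); rewrite /hval => p0 t0.
  by rewrite min_r ?max_r ?ger0_norm//; lra.
Qed.

(** Mass is linear, so a straight segment does not come closer to the apex than its lower
    endpoint. *)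
Lemma conv_mass_ge (x y : V -> R) (l : R) : 0 <= l <= 1 ->
  Num.min (mass x) (mass y) <= mass (fun v => (1 - l) * x v + l * y v).
Proof.
move=> /andP[l0 l1]; rewrite massD !massZ minEle; case: ifPn => [xy|].
  by have := ler_wpM2l l0 xy; lra.
rewrite -ltNge => /ltW yx; have l1' : 0 <= 1 - l by lra.
by have := ler_wpM2l l1' yx; lra.
Qed.

Lemma conv_admissible z z' (l : R) : 0 <= l <= 1 ->
  supp (W z) :|: supp (W z') \in F ->
  admissible F (fun v => (1 - l) * W z v + l * W z' v).
Proof.
move=> /andP[l0 l1] zz'; have l1' : 0 <= 1 - l by lra.
split=> [v|]; first by rewrite addr_ge0// mulr_ge0.
by apply: (chart_face ch zz'); exact: supp_conv.
Qed.

(** Moving the endpoints at fixed [l] gives the first two terms; changing [l] afterwards gives the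
    third. *)
Lemma l1_conv (x y x' y' : V -> R) (l l' : R) : 0 <= l <= 1 ->
    (forall v, 0 <= x' v) -> (forall v, 0 <= y' v) ->
  l1 (fun v => (1 - l) * x v + l * y v) (fun v => (1 - l') * x' v + l' * y' v)
  <= l1 x x' + l1 y y' + `|l - l'| * (mass x' + mass y').
Proof.
move=> /andP[la lb] x0 y0.
apply: le_trans (l1_triangle (fun v => (1 - l) * x' v + l * y' v) _ _) _.
apply: lerD; apply: le_trans (l1D _ _ _ _) _.
  by rewrite !l1_scale lerD// ler_piMl ?l1_ge0// ger0_norm; lra.
rewrite !l1_lin//; have -> : 1 - l - (1 - l') = - (l - l') by ring.
by rewrite normrN mulrDr.
Qed.

(* The homotopy takes time [|f| + |g|], so that it moves at bounded speed. *)
Lemma coarse_homotopic_straight f g : coarse f -> coarse g ->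
  (forall t, supp (W (f t)) :|: supp (W (g t)) \in F) -> coarse_homotopic f g.
Proof.
move=> /coarse_rayP[cf pf] /coarse_rayP[cg pg] fg.
pose q (t : halfline R) := hl (mass (W (f t)) + mass (W (g t))).
have qE t : hval (q t) = mass (W (f t)) + mass (W (g t)).
  by rewrite val_hl// addr_ge0// mass_ge0.
have q0 t := halfline_ge0 (q t).
(* For [q t] equal to 0 the quotient is 0, since the inverse of 0 is 0. *)
have unit t s : 0 <= s <= hval (q t) -> 0 <= s / hval (q t) <= 1.
  move=> /andP[s0 sq]; rewrite divr_ge0//=.
  have := q0 t; rewrite le_eqVlt => /orP[/eqP <-|qt]; first by rewrite invr0 mulr0.
  by rewrite ler_pdivrMr// mul1r.
have cq d : 0 < d -> exists2 e : R, 0 < e & forall t t', `|hval t - hval t'| < d ->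
    l1 (W (f t)) (W (f t')) + l1 (W (g t)) (W (g t')) <= e /\
    `|hval (q t) - hval (q t')| <= e.
  move=> d0; have [a fa] := cf _ d0; have [b gb] := cg _ d0.
  exists (`|a + b| + 1) => [|t t' tt']; first by rewrite ltr_wpDl.
  have := fa _ _ tt'; have := gb _ _ tt'; have := ler_norm (a + b).
  split; first lra.
  rewrite !qE opprD addrACA (le_trans (ler_normD _ _))//.
  have := mass_l1 (W (f t)) (W (f t')); have := mass_l1 (W (g t)) (W (g t')).
  lra.
apply: (coarse_homotopic_weights (q := q) (h := fun t s v =>
  (1 - s / hval (q t)) * W (f t) v + s / hval (q t) * W (g t) v)).
- apply: coarse_halflineP.
    move=> d /cq[e _ qe]; exists e => t t' /qe[].
    by [].
  move=> M; have [N fN] := pf M; exists N => t; rewrite qE => h; apply: fN.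
  have : 0 <= mass (W (g t)) by rewrite mass_ge0.
  lra.
- by move=> t s ts; apply: conv_admissible => //; exact: unit.
- move=> d d0; have [e e0 qe] := cq _ d0.
  exists (e + (d + e)) => t t' s s' ts ts' tt' ss'.
  apply: le_trans (l1_conv _ _ _ _ _ _) _ => //; first exact: unit.
  have [h1 h2] := qe _ _ tt'; apply: lerD => //.
  (* The masses in [l1_conv] add up to [q t']. Multiplied by it, the difference of the parameters
     becomes [s - s'] plus at most the change of [q]. *)
  rewrite -qE -[X in _ * X]ger0_norm// -normrM mulrBl.
  have -> : s' / hval (q t') * hval (q t') = s'.
    have := q0 t'; rewrite le_eqVlt => /orP[/eqP qt'|qt'].
      by move: ts'; rewrite -qt' -eq_le => /eqP <-; rewrite mulr0.
    by rewrite divfK// gt_eqF.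
  have -> : s / hval (q t) * hval (q t') - s' =
      (s - s') + s / hval (q t) * (hval (q t') - hval (q t)).
    have := q0 t; rewrite le_eqVlt => /orP[/eqP qt|qt].
      move: ts; rewrite -qt -eq_le eq_sym => /eqP ->; ring.
    by field; rewrite gt_eqF.
  apply: le_trans (ler_normD _ _) _; apply: lerD; first exact: ltW.
  have /andP[? ?] := unit _ _ ts.
  by rewrite normrM ger0_norm// distrC (le_trans _ h2)// ler_piMl.
- move=> M; have [N fN] := pf M; have [N' gN] := pg M.
  exists (Num.max N N') => t s /unit ts /(le_trans (conv_mass_ge _ _ ts)).
  by rewrite ge_min le_max => /orP[/fN ->//|/gN ->]; rewrite orbT.
- by move=> t; apply/funext => v; rewrite mul0r subr0 mul1r mul0r addr0.
(* If [q t] is 0, the formula yields [W (f t)], but then [f t] and [g t] are both the apex. *)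
- move=> t; apply/funext => v; have := q0 t.
  rewrite le_eqVlt => /orP[/eqP qt|qt].
    have mf : 0 <= mass (W (f t)) by rewrite mass_ge0.
    have mg : 0 <= mass (W (g t)) by rewrite mass_ge0.
    have zero (z : Z) : mass (W z) = 0 -> W z v = 0.
      move=> z0; apply/le_anti; rewrite chart_ge0 andbT leNgt; apply/negP => zv.
      have := @supp_mass_gt0 _ _ (W z) v; rewrite inE zv z0 ltxx => h.
      by have := h (chart_ge0 z) isT.
    by move: (qE t); rewrite -qt => mfg; rewrite !zero ?mulr0 ?addr0//; lra.
  by rewrite divff ?gt_eqF// subrr mul0r add0r mul1r.
Qed.

End chart.

(** * Components and ends *)

Section components.
Context {R : realType} {V : finType} (F : {set {set V}}).
Implicit Types (w : V -> R) (u v : V).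

Definition edge : rel V := fun u v => [set u; v]%SET \in F.

(** Any two vertices of a support in [F] span an edge, so the root does not depend on the vertex
    picked. [None] is left for the apex, which belongs to no component. *)
Definition component w : option V :=
  omap (fingraph.root edge) [pick v in supp w].

Lemma edge_connect_sym : connect_sym edge.
Proof. by apply: sym_connect_sym => u v; rewrite /edge finset.setUC. Qed.

Hypothesis F_sub : forall s t : {set V}, s \in F -> t \subset s -> t \in F.

Lemma supp_edge w u v : supp w \in F -> u \in supp w -> v \in supp w -> edge u v.
Proof.
move=> wF uw vw; apply: F_sub wF _; apply/fintype.subsetP => x.
by rewrite !inE => /orP[] /eqP ->; rewrite -mem_supp.
Qed.

Lemma component_supp w v : supp w \in F -> v \in supp w ->
  component w = Some (fingraph.root edge v).
Proof.
move=> wF vw; rewrite /component; case: pickP => [u uw|/(_ v)]; last by rewrite vw.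
congr Some; apply/(fingraph.rootP edge_connect_sym)/connect1; exact: (supp_edge wF).
Qed.

Lemma component_vertex w : admissible F w -> 0 < mass w -> exists v,
  [/\ v \in supp w, [set v]%SET \in F &
      component w = Some (fingraph.root edge v)].
Proof.
move=> [w0 wF] /(mass_gt0P w0)[v vw]; exists v; split => //.
  by apply: F_sub wF _; rewrite finset.sub1set.
exact: component_supp.
Qed.

Lemma component_near w w' : admissible F w -> admissible F w' ->
  l1 w w' < mass w -> component w = component w'.
Proof.
move=> [w0 wF] [w'0 w'F] /(supp_meet w0 w'0)[v]; rewrite inE => /andP[vw vw'].
by rewrite (component_supp wF vw) (component_supp w'F vw').
Qed.

End components.

Lemma hl_hval {R : realType} (t : halfline R) : hl (hval t) = t.
Proof. by apply: val_inj; rewrite /= ger0_norm// halfline_ge0. Qed.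

(** Replaces connectedness for coarse maps, which need not be continuous: any [s] is reached from
    [a] by finitely many steps of length at most 1. *)
Lemma unit_step_constant {R : realType} (I : Type) (k : R -> I) (a : R) :
  (forall s s', a <= s -> s <= s' -> s' <= s + 1 -> k s = k s') ->
  forall s, a <= s -> k s = k a.
Proof.
move=> kE s sa.
suff h n : forall s, a <= s -> s <= a + n%:R -> k s = k a.
  by apply: (h (Num.truncn (s - a)).+1) => //; have := truncnS_gt (s - a); lra.
elim: n => [|n IH] {sa} x xa; first by move=> ?; congr k; lra.
rewrite -natr1 => xn; have [?|?] := leP x (a + 1); first by rewrite -(kE a x).
by rewrite -(kE (x - 1) x) ?IH//; lra.
Qed.

Lemma lipschitz_cont {R : realType} (T Z : metricType R) (f : T -> Z) (K : R) :
  (forall x y, mdist (f x) (f y) <= K * mdist x y) -> continuous f.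
Proof.
move=> fK x; apply/cvg_ballP => e e0.
have K0 : 0 < `|K| + 1 by rewrite ltr_wpDl.
have : nbhs x (ball x (e / (`|K| + 1))) by apply: nbhsx_ballx; exact: divr_gt0.
apply: filterS => y; rewrite !ballEmdist /= ltr_pdivlMr// => xy.
rewrite (le_lt_trans (fK _ _))// (le_lt_trans _ xy)// mulrC.
by rewrite ler_wpM2l ?mdist_ge0// (le_trans (ler_norm _))// lerDl.
Qed.

(** * Labels of rays, and the classification of ends by them *)

Section labels.
Context {R : realType} {V : finType} {Z : metricType R}.
Context {F : {set {set V}}} {W : Z -> V -> R} {C : R} (ch : cone_chart F W C).
Implicit Types (z : Z) (v : V) (r f g : halfline R -> Z) (k : option V).

Let W_ge0 z v : 0 <= W z v.
Proof. exact: (chart_ge0 ch). Qed.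
Local Hint Resolve W_ge0 : core.

(** The common invariant: equality of labels will characterize both equivalence of end rays and
    coarse homotopy of coarse rays. *)
Definition ray_label r k : Prop :=
  exists T : R, forall t, T <= hval t -> component F (W (r t)) = k.

Let F_sub (s t : {set V}) : s \in F -> t \subset s -> t \in F.
Proof. exact: (chart_face ch). Qed.

Lemma ray_label_inj r k k' : ray_label r k -> ray_label r k' -> k = k'.
Proof.
move=> [T rT] [T' rT']; pose t := hl (`|T| + `|T'|).
have tE : hval t = `|T| + `|T'| by rewrite val_hl// addr_ge0.
rewrite -(rT t) ?(rT' t)// tE; have := ler_norm T; have := ler_norm T'.
  by have := normr_ge0 T; lra.
by have := normr_ge0 T'; lra.
Qed.

Lemma coarse_ray_label r : coarse r -> exists v, [set v]%SET \in F /\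
  ray_label r (Some (fingraph.root (edge F) v)).
Proof.
(* Control is stated for distances strictly below a bound; 2 covers the closed unit steps. *)
move=> /(coarse_rayP ch)[cr pr]; have [e re] := cr 2 (ltr0n _ 2).
have [N rN] := pr `|e|; pose T := `|N| + 1.
have T0 : 0 < T by rewrite ltr_wpDl.
have big t : T <= t -> `|e| < mass (W (r (hl t))).
  move=> Tt; rewrite ltNge; apply/negP => /rN; rewrite val_hl; last lra.
  by have := ler_norm N; rewrite /T in Tt; lra.
have [|v [_ vF rv]] := component_vertex F_sub (chart_adm ch (r (hl T))).
  by apply: le_lt_trans (big _ _) => //.
exists v; split => //; exists T => t Tt; rewrite -rv -[t in LHS]hl_hval.
apply: (@unit_step_constant _ _ (fun s => component F (W (r (hl s))))) Tt.
move=> s s' Ts ss' s'1; apply: component_near => //; try exact: (chart_adm ch).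
apply: le_lt_trans (big _ Ts); apply: le_trans (ler_norm _); apply: re.
by rewrite !val_hl; [rewrite distrC ger0_norm|..]; lra.
Qed.

(** For a fixed late [t] the track of the homotopy is followed in unit time steps. By properness it
    stays higher than the bound [e] on each step, so no step changes the component. *)
Lemma coarse_homotopic_label f g k : coarse_homotopic f g ->
  ray_label f k -> ray_label g k.
Proof.
move=> [q [H [_ [cH pH] H0 H1]]] [T fT].
have [e He] := (controlled_l1P ch H).1 cH 2 (ltr0n _ 2).
have /cyl_pt_bounded/halfline_bounded[N HN] := (proper_massP ch H).1 pH `|e|.
exists (Num.max T (N + 1)) => t; rewrite ge_max => /andP[Tt Nt].
rewrite -(fT _ Tt).
(* Since [mk_cyl] clamps the time, this holds for every real [s]. *)
have big s : e < mass (W (H (mk_cyl q t s))).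
  apply: le_lt_trans (ler_norm _) _; rewrite ltNge; apply/negP => h.
  suff : hval t <= N by lra.
  by apply: HN; exists (mk_cyl q t s).
have t0 : cyl_time (mk_cyl q t 0) = 0.
  by rewrite cyl_time_mk /clamp maxxx min_l// halfline_ge0.
have t1 : cyl_time (mk_cyl q t (hval (q t))) = hval (q t).
  by rewrite cyl_time_mk /clamp max_r ?halfline_ge0// minxx.
rewrite -[f t](H0 (mk_cyl q t 0))// -[g t](H1 (mk_cyl q t (hval (q t))))//.
apply: (@unit_step_constant _ _ (fun s => component F (W (H (mk_cyl q t s))))).
  move=> s s' _ ss' s'1; apply: component_near => //; try exact: (chart_adm ch).
  apply: le_lt_trans (big s); apply: He.
  by apply: mk_cyl_dist; rewrite ?mdistxx ?subrr ?normr0// ger0_norm; lra.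
exact: halfline_ge0.
Qed.

Lemma component_local z z' : C * mdist z z' < mass (W z) ->
  0 < mass (W z') /\ component F (W z) = component F (W z').
Proof.
move=> zz'; have := le_lt_trans (chart_l1 ch z z') zz' => l.
split; last by apply: component_near => //; exact: (chart_adm ch).
have := le_lt_trans (mass_l1 (W z) (W z')) l.
by rewrite ltr_norml => /andP[? ?]; lra.
Qed.

(** Away from the apex [component] is locally constant. The arbitrary [P] covers both a single value
    and its complement. *)
Lemma component_open (P : set (option V)) :
  open [set z | 0 < mass (W z) /\ P (component F (W z))].
Proof.
have C0 := chart_cst ch; rewrite openE => z [z0 Pz].
have : nbhs z (ball z (mass (W z) / C)) by apply: nbhsx_ballx; exact: divr_gt0.
apply: filterS => y; rewrite ballEmdist /= ltr_pdivlMr// mulrC.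
by move=> /component_local[y0 <-].
Qed.

Lemma path_joined_component (A : set Z) z z' :
  (forall y, A y -> 0 < mass (W y)) -> path_joined (R := R) A z z' ->
  component F (W z) = component F (W z').
Proof.
move=> A0 [g [cg <- <- gA]].
have cn : connected (g @` `[0, 1]).
  by apply: connected_continuous_connected cg; exact: segment_connected.
have I0 : `[0, 1]%classic (0 : R) by rewrite /= in_itv/= lexx ler01.
have I1 : `[0, 1]%classic (1 : R) by rewrite /= in_itv/= lexx ler01.
pose k := component F (W (g 0)).
have pos y : (g @` `[0, 1]) y -> 0 < mass (W y) by move=> /gA /A0.
(* The points of the path in the component [k] form a nonempty, relatively open and relatively
   closed subset of a connected set. *)
have E : (g @` `[0, 1]) `&` [set y | component F (W y) = k] = g @` `[0, 1].
  apply: cn.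
  - by exists (g 0); split => //; exists 0.
  - exists [set y | 0 < mass (W y) /\ [set k] (component F (W y))].
      exact: component_open.
    by apply/seteqP; split=> y [yI] => [yk|[_ yk]]; split=> //; split=> //; exact: pos.
  - exists (~` [set y | 0 < mass (W y) /\ (~` [set k]) (component F (W y))]).
      by apply: open_closedC; exact: component_open.
    apply/seteqP; split=> y [yI yk]; split => //; first by case.
    by apply: contrapT => h; apply: yk; split => //; exact: pos.
have : (g @` `[0, 1]) (g 1) by exists 1.
by rewrite -E => -[_ ->].
Qed.

Lemma mass_bounded (M : R) : mbounded [set z | mass (W z) <= M].
Proof. by apply/(bounded_massP ch); exists M. Qed.

Lemma end_ray_label r : end_rays Z r -> exists v, [set v]%SET \in F /\
  ray_label r (Some (fingraph.root (edge F) v)).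
Proof.
(* The bounded set removed is the apex; a tail of [r] then lies in one path component of the
   rest. *)
move=> er; have [t [D [x xB ->] [rD _]]] := ends_equiv_refl er (mass_bounded 0).
have pos y : (~` [set z | mass (W z) <= 0]) y -> 0 < mass (W y).
  by move=> /= /negP; rewrite -ltNge.
have [v [_ vF xv]] := component_vertex F_sub (chart_adm ch x) (pos _ xB).
exists v; split => //; exists (hval t) => s ts.
by rewrite -xv; apply/esym/(path_joined_component pos)/rD; exists s.
Qed.

Lemma ends_equiv_label r r' k k' : ends_equiv r r' ->
  ray_label r k -> ray_label r' k' -> k = k'.
Proof.
move=> /(_ _ (mass_bounded 0))[t [D [x xB ->] [rD r'D]]] [T rT] [T' rT'].
have pos y : (~` [set z | mass (W z) <= 0]) y -> 0 < mass (W y).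
  by move=> /= /negP; rewrite -ltNge.
pose m := `|T| + `|T'| + hval t; pose s := hl m.
have t0 := halfline_ge0 t; have T0 := normr_ge0 T; have T'0 := normr_ge0 T'.
have := ler_norm T; have := ler_norm T'.
have sE : hval s = m by rewrite val_hl// !addr_ge0.
move=> T'n Tn; rewrite -(rT s) ?sE ?/m; last lra.
rewrite -(rT' s) ?sE ?/m; last lra.
transitivity (component F (W x)).
  by apply/esym/(path_joined_component pos)/rD; exists s => //=; rewrite sE /m; lra.
by apply/(path_joined_component pos)/r'D; exists s => //=; rewrite sE /m; lra.
Qed.

Lemma path_joined_straight (M : R) z z' : M < mass (W z) -> M < mass (W z') ->
  supp (W z) :|: supp (W z') \in F ->
  path_joined (R := R) [set y | M < mass (W y)] z z'.
Proof.
move=> Mz Mz' zz'; have C0 := chart_cst ch.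
(* Clipping the parameter defines the segment on the whole half line, so that [lipschitz_cont] gives
   its continuity; [hl] then turns it into a path over [R]. *)
pose l (t : halfline R) := Num.min (hval t) 1.
have l01 t : 0 <= l t <= 1.
  by rewrite /l le_min halfline_ge0 ler01 ge_min lexx orbT.
have [g gE] := chart_lift ch (fun t => conv_admissible ch (l01 t) zz').
have W1 x : 0 <= x -> x <= 1 -> l (hl x) = x by move=> ? ?; rewrite /l val_hl// min_l.
have cg : continuous g.
  apply: (@lipschitz_cont _ _ _ _ (C * (mass (W z) + mass (W z')))) => t t'.
  rewrite (le_trans (chart_dist ch _ _))// -mulrA ler_pM2l// !gE.
  apply: le_trans (l1_conv _ _ _ _ _ _) _ => //.
  rewrite !l1xx !add0r mulrC ler_wpM2l// ?addr_ge0 ?mass_ge0//.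
  rewrite metric_sym halfline_dist /l !minEle.
  have := halfline_ge0 t; have := halfline_ge0 t'.
  have := ler_norm (hval t - hval t'); have := ler_norm (- (hval t - hval t')).
  rewrite normrN => *; rewrite ler_norml.
  by do !case: ifPn; rewrite -?ltNge => *; apply/andP; split; lra.
exists (g \o hl); split.
- apply: continuous_subspaceT => x; apply: continuous_comp; last exact: cg.
  exact: hl_continuous.
- apply: (chart_inj ch); rewrite gE W1//; apply/funext => v.
  by rewrite subr0 mul1r mul0r addr0.
- apply: (chart_inj ch); rewrite gE W1//; apply/funext => v.
  by rewrite subrr mul1r mul0r add0r.
- move=> _ [x _ <-] /=; rewrite gE (lt_le_trans _ (conv_mass_ge _ _ (l01 _)))//.
  by rewrite lt_min Mz.
Qed.

Lemma vertex_point (c : R) v : 0 <= c -> [set v]%SET \in F ->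
  exists z, W z = fun u => c * vertex v u.
Proof.
move=> c0 vF; apply: (chart_surj ch); split=> [u|].
  by rewrite mulr_ge0// vertex_ge0.
move: c0; rewrite le_eqVlt => /orP[/eqP <-|c0]; last first.
  by rewrite suppZ// supp_vertex.
apply: F_sub vF _; apply/fintype.subsetP => u.
by rewrite mem_supp mul0r ltxx.
Qed.

Lemma edge_vertexF u v : edge F u v -> [set v]%SET \in F.
Proof. by move=> uv; apply: F_sub uv _; rewrite finset.sub1set !inE eqxx orbT. Qed.

(** The edges are crossed one by one at the constant height [c]. *)
Lemma path_joined_vertices (M c : R) u v z z' : 0 < c -> M < c ->
  [set u]%SET \in F -> connect (edge F) u v ->
  W z = (fun x => c * vertex u x) -> W z' = (fun x => c * vertex v x) ->
  path_joined (R := R) [set y | M < mass (W y)] z z'.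
Proof.
move=> c0 Mc uF /connectP[p + ->].
elim: p u uF z => [|w p IH] u uF z /= => [_ zE z'E|/andP[uw pw] zE z'E].
  have -> : z = z' by apply: (chart_inj ch); rewrite zE z'E.
  by apply: path_joined_refl; rewrite /= z'E massZ mass_vertex mulr1.
have wF := edge_vertexF uw; have [y yE] := vertex_point (ltW c0) wF.
apply: path_joined_trans (IH w wF y pw yE z'E).
apply: path_joined_straight; rewrite ?zE ?yE ?massZ ?mass_vertex ?mulr1//.
by rewrite !suppZ// !supp_vertex.
Qed.

(** From [z] straight to a vertex of its support at height [M + 1], along edges at that height, and
    straight to [z']. *)
Lemma path_joined_same_component (M : R) z z' : 0 <= M -> M < mass (W z) ->
  M < mass (W z') -> component F (W z) = component F (W z') ->
  path_joined (R := R) [set y | M < mass (W y)] z z'.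
Proof.
move=> M0 Mz Mz' zz'; have z0 := le_lt_trans M0 Mz; have z'0 := le_lt_trans M0 Mz'.
have [u [uz uF uE]] := component_vertex F_sub (chart_adm ch z) z0.
have [v [vz vF vE]] := component_vertex F_sub (chart_adm ch z') z'0.
have uv : connect (edge F) u v.
  by apply/(fingraph.rootP (edge_connect_sym F)); move: zz'; rewrite uE vE => -[].
pose c := M + 1; have c0 : 0 < c by rewrite ltr_wpDl.
have Mc : M < c by rewrite ltrDl.
have [y yE] := vertex_point (ltW c0) uF; have [y' y'E] := vertex_point (ltW c0) vF.
have my x a : W x = (fun b => c * vertex a b) -> mass (W x) = c.
  by move=> ->; rewrite massZ mass_vertex mulr1.
have to_vertex x y1 a : M < mass (W x) -> a \in supp (W x) ->
    W y1 = (fun b => c * vertex a b) ->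
    path_joined (R := R) [set y | M < mass (W y)] x y1.
  move=> Mx ax y1E; apply: path_joined_straight => //; first by rewrite (my _ _ y1E).
  have -> : supp (W x) :|: supp (W y1) = supp (W x).
    by apply/finset.setUidPl; rewrite y1E suppZ// supp_vertex finset.sub1set.
  exact: (chart_supp ch).
apply: path_joined_trans (to_vertex _ _ _ Mz uz yE) _.
apply: path_joined_trans (path_joined_vertices c0 Mc uF uv yE y'E) _.
by apply/path_joined_sym; exact: (to_vertex _ _ _ Mz' vz y'E).
Qed.

Lemma same_label_ends_equiv r r' k : metrically_proper r ->
  metrically_proper r' -> ray_label r k -> ray_label r' k -> ends_equiv r r'.
Proof.
move=> /(proper_rayP ch) pr /(proper_rayP ch) pr' [T rT] [T' rT'] B.
move=> /(bounded_massP ch)[M BM].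
have [N rN] := pr `|M|; have [N' r'N'] := pr' `|M|.
(* From this time on both labels are settled and both rays stay above height [|M|], hence outside
   [B]. *)
pose m := `|T| + `|T'| + `|N| + `|N'| + 1; pose t := hl m.
have tE : hval t = m by rewrite val_hl// !addr_ge0.
have T0 := normr_ge0 T; have T'0 := normr_ge0 T'.
have N0 := normr_ge0 N; have N'0 := normr_ge0 N'.
have nT := ler_norm T; have nT' := ler_norm T'.
have nN := ler_norm N; have nN' := ler_norm N'.
have rM s : hval t <= hval s -> `|M| < mass (W (r s)).
  by rewrite tE /m => ms; rewrite ltNge; apply/negP => /rN; lra.
have r'M s : hval t <= hval s -> `|M| < mass (W (r' s)).
  by rewrite tE /m => ms; rewrite ltNge; apply/negP => /r'N'; lra.
have sub : [set y | `|M| < mass (W y)] `<=` ~` B.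
  by move=> y /= My /BM; have := ler_norm M; lra.
have joined z : `|M| < mass (W z) -> component F (W z) = k ->
    path_joined (R := R) (~` B) (r t) z.
  move=> Mz zk.
  have [g [cg g0 g1 gA]] : path_joined (R := R) [set y | `|M| < mass (W y)] (r t) z.
    apply: path_joined_same_component => //; first exact: rM.
    by rewrite zk rT// tE /m; lra.
  by exists g; split => //; exact: subset_trans sub.
exists t, [set z | path_joined (R := R) (~` B) (r t) z].
  by exists (r t) => //; apply: sub; exact: rM.
split=> _ [s /= ts <-]; apply: joined; rewrite ?rM ?r'M//.
  by apply: rT; move: ts; rewrite tE /m; lra.
by apply: rT'; move: ts; rewrite tE /m; lra.
Qed.

End labels.

(** * Coarse classes of rays *)

Section walk.
Context {R : realType} {V : finType} (p : nat -> V).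
Implicit Types u : R.

(** The piecewise linear path in the complex that passes [p j] at time [j]. *)
Definition walk u : V -> R := fun x =>
  (1 - (u - (Num.truncn u)%:R)) * vertex (p (Num.truncn u)) x +
  (u - (Num.truncn u)%:R) * vertex (p (Num.truncn u).+1) x.

Lemma frac_itv u : 0 <= u -> 0 <= u - (Num.truncn u)%:R <= 1.
Proof.
move=> /truncn_itv /andP[? h]; move: (ltW h); rewrite -natr1 => ?.
by apply/andP; split; lra.
Qed.

Lemma walk_ge0 u x : 0 <= u -> 0 <= walk u x.
Proof.
move=> /frac_itv /andP[? ?].
by rewrite addr_ge0// mulr_ge0// ?vertex_ge0// subr_ge0.
Qed.

Lemma mass_walk u : mass (walk u) = 1.
Proof. by rewrite massD !massZ !mass_vertex; ring. Qed.

Lemma walk0 : walk 0 = vertex (p 0).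
Proof.
by apply/funext => x; rewrite /walk truncn0 subrr subr0 mul1r mul0r addr0.
Qed.

Lemma supp_walk u : 0 <= u ->
  supp (walk u) \subset [set p (Num.truncn u); p (Num.truncn u).+1]%SET.
Proof.
move=> /frac_itv /andP[? ?].
rewrite -(supp_vertex (R := R)) -(supp_vertex (R := R) (p _.+1)).
by apply: supp_conv => //; [lra|exact: vertex_ge0..].
Qed.

(** The constant is the [l1] length of an edge between distinct vertices. *)
Lemma walk_lipschitz u u' : 0 <= u -> 0 <= u' ->
  l1 (walk u) (walk u') <= 2 * `|u - u'|.
Proof.
wlog uu' : u u' / u <= u' => [H u0 u'0|u0 u'0].
  have [/H->//|/ltW/H h] := leP u u'.
  by rewrite l1_sym distrC h.
rewrite distrC ger0_norm ?subr_ge0//.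
(* Weights of mass 1 are at most 2 apart, which settles times at least 1 apart. Closer times lie on
   the same edge or on consecutive ones. *)
have [far|near] := leP 1 (u' - u).
  rewrite (le_trans (l1_le_mass _ _))// ?mass_walk; last lra.
    by move=> v; exact: walk_ge0.
  by move=> v; exact: walk_ge0.
have same (x y : V) (l l' : R) : 0 <= l <= 1 ->
    l1 (fun v => (1 - l) * vertex x v + l * vertex y v)
       (fun v => (1 - l') * vertex x v + l' * vertex y v) <= 2 * `|l - l'|.
  move=> l01; apply: le_trans (l1_conv _ _ _ _ _ _) _ => //; try exact: vertex_ge0.
  by rewrite !l1xx !mass_vertex; lra.
have nn : (Num.truncn u <= Num.truncn u')%N by exact: le_truncn.
have /andP[fu fu1] := frac_itv u0; have /andP[fu' fu'1] := frac_itv u'0.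
have := nn; rewrite leq_eqVlt => /orP[/eqP E|lt].
  rewrite /walk -E in fu' fu'1 *; apply: le_trans (same _ _ _ _ _) _.
    by rewrite fu.
  by rewrite distrC ger0_norm; lra.
have E : Num.truncn u' = (Num.truncn u).+1.
  apply/eqP; rewrite eqn_leq lt andbT -ltnS -(ltr_nat R).
  have := truncn_itv u'0 => /andP[h _]; apply: le_lt_trans h _.
  by rewrite -!natr1; have := truncnS_gt u; rewrite -natr1; lra.
rewrite /walk E -[(Num.truncn u).+1%:R]natr1 in fu' fu'1 *.
set n := Num.truncn u in fu fu1 fu' fu'1 *.
(* The vertex shared by consecutive edges is the end of one, with parameter 1, and the start of the
   next, with parameter 0. *)
pose c : V -> R := fun v => vertex (p n.+1) v.
apply: le_trans (l1_triangle c _ _) _.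
have -> : 2 * (u' - u) = 2 * `|u - n%:R - 1| + 2 * `|0 - (u' - (n%:R + 1))|.
  by rewrite distrC sub0r normrN !ger0_norm; lra.
apply: lerD; rewrite /c.
  have {1}-> : (fun v => vertex (p n.+1) v) = (fun v => (1 - 1) * vertex (p n) v +
      1 * vertex (p n.+1) v) :> (V -> R).
    by apply/funext => v; rewrite subrr mul0r mul1r add0r.
  by apply: same; rewrite fu.
have {1}-> : (fun v => vertex (p n.+1) v) = (fun v => (1 - 0) * vertex (p n.+1) v +
    0 * vertex (p n.+2) v) :> (V -> R).
  by apply/funext => v; rewrite subr0 mul0r mul1r addr0.
by apply: same; rewrite lexx ler01.
Qed.

(* At height [u], the walk traced back from time [u] at speed [1 / u]; it has
   returned to its origin when [s = u ^+ 2] (for [u = 0] this is the apex). *)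
Definition unwind u (s : R) : V -> R := fun x => u * walk (u - s / u) x.

Lemma unwind_time u s : 0 <= u -> s <= u ^+ 2 -> 0 <= u - s / u.
Proof.
rewrite le_eqVlt => /orP[/eqP <-|u0] su; first by rewrite invr0 mulr0 subrr.
by rewrite subr_ge0 ler_pdivrMr// -expr2.
Qed.

Lemma mass_unwind u s : mass (unwind u s) = u.
Proof. by rewrite massZ mass_walk mulr1. Qed.

Lemma supp_unwind u s : 0 <= u -> s <= u ^+ 2 -> supp (unwind u s) \subset
  [set p (Num.truncn (u - s / u)); p (Num.truncn (u - s / u)).+1]%SET.
Proof.
move=> u0 /(unwind_time u0) tau; apply: fintype.subset_trans (supp_walk tau).
apply/fintype.subsetP => x; rewrite !mem_supp => h.
rewrite lt_neqAle walk_ge0// andbT; apply/eqP => x0.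
by move: h; rewrite /unwind -x0 mulr0 ltxx.
Qed.

Lemma unwind_admissible (F : {set {set V}}) u s :
  (forall s t : {set V}, s \in F -> t \subset s -> t \in F) ->
  (forall j, edge F (p j) (p j.+1)) -> 0 <= u -> s <= u ^+ 2 ->
  admissible F (unwind u s).
Proof.
move=> F_sub pF u0 su; split; last exact: F_sub (pF _) (supp_unwind u0 su).
by move=> x; rewrite mulr_ge0// walk_ge0//; exact: unwind_time.
Qed.

(** As [|u - u'| <= u + u'], the square of [u - u'] is below [d], and a number with square below [d]
    is at most [1 + d]. *)
Lemma sqr_dist u u' (d : R) : 0 <= u -> 0 <= u' ->
  `|u ^+ 2 - u' ^+ 2| < d -> `|u - u'| <= 1 + d.
Proof.
move=> u0 u'0; rewrite subr_sqr normrM [`|u + u'|]ger0_norm; last lra.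
have : `|u - u'| <= u + u' by rewrite ler_norml; apply/andP; split; lra.
have := normr_ge0 (u - u'); move: `|u - u'| (u + u') => a b; nra.
Qed.

(** The change of height costs [1 + d]. At the lower height [u'], the change of the walk parameter
    times [u'] is at most [2 * d], and the Lipschitz constant 2 of the walk makes this [4 * d]. *)
Lemma unwind_controlled u u' s s' (d : R) : 0 <= u -> 0 <= u' ->
  0 <= s <= u ^+ 2 -> 0 <= s' <= u' ^+ 2 ->
  `|u ^+ 2 - u' ^+ 2| < d -> `|s - s'| < d ->
  l1 (unwind u s) (unwind u' s') <= 1 + 5 * d.
Proof.
wlog uu' : u u' s s' / u' <= u => [H u0 u'0 su su'|u0 u'0 su su'] tt' ss'.
  have [/H->//|/ltW/H h] := leP u' u.
  by rewrite l1_sym h// distrC.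
have uud := sqr_dist u0 u'0 tt'.
have /andP[s0 s1] := su; have /andP[s'0 s'1] := su'.
have tau := unwind_time u0 s1; have tau' := unwind_time u'0 s'1.
apply: le_trans (l1_triangle (fun x => u' * walk (u - s / u) x) _ _) _.
rewrite l1_lin; last by move=> v; exact: walk_ge0.
rewrite mass_walk mulr1 l1_scale [`|u'|]ger0_norm//.
suff : u' * `|(u - s / u) - (u' - s' / u')| <= 2 * d.
  by have := ler_wpM2l u'0 (walk_lipschitz tau tau'); lra.
rewrite -{1}[u']ger0_norm// -normrM.
move: (uu') tt'; rewrite le_eqVlt => /orP[/eqP E|lt] tt'.
  have [u00|u00] := eqVneq u 0.
    by rewrite E u00 mul0r normr0; have := normr_ge0 (s - s'); lra.
  have -> : u' * (u - s / u - (u' - s' / u')) = s' - s by rewrite E; field.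
  by rewrite distrC; have := normr_ge0 (s - s'); lra.
have up : 0 < u by exact: le_lt_trans lt.
(* Also for [u' = 0], where the bounds force [s' = 0]. *)
have s'E : u' * (s' / u') = s'.
  have := u'0; rewrite le_eqVlt => /orP[/eqP u'00|u'p].
    by move: s'0 s'1; rewrite -u'00 expr0n/= mul0r => ? ?; apply/le_anti/andP.
  by rewrite mulrC divfK// gt_eqF.
(* Since [s / u <= u], the first and the last term are nonnegative with sum at most
   [u ^+ 2 - u' ^+ 2]; the middle one is below [d] in absolute value. *)
have -> : u' * (u - s / u - (u' - s' / u')) =
    u' * (u - u') - (s - s') + s / u * (u - u').
  rewrite !mulrBr s'E; field; by rewrite gt_eqF.
have a0 : 0 <= u' * (u - u') by rewrite mulr_ge0// subr_ge0.
have b0 : 0 <= s / u * (u - u') by rewrite !mulr_ge0 ?invr_ge0// subr_ge0.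
have b1 : s / u * (u - u') <= u * (u - u').
  by rewrite ler_wpM2r ?subr_ge0// ler_pdivrMr// -expr2.
have dd : u * (u - u') + u' * (u - u') < d.
  have -> : u * (u - u') + u' * (u - u') = u ^+ 2 - u' ^+ 2 by ring.
  exact: le_lt_trans (ler_norm _) tt'.
by move: ss'; rewrite ltr_norml => /andP[? ?]; rewrite ler_norml; apply/andP; split; lra.
Qed.

End walk.

(** * Classification of coarse rays by their labels *)

Section coarse_classification.
Context {R : realType} {V : finType} {Z : metricType R}.
Context {F : {set {set V}}} {W : Z -> V -> R} {C : R} (ch : cone_chart F W C).
Implicit Types (z : Z) (v : V) (r f g : halfline R -> Z) (k : option V).

Let W_ge0 z v : 0 <= W z v.
Proof. exact: (chart_ge0 ch). Qed.
Local Hint Resolve W_ge0 : core.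

Let F_sub (s t : {set V}) : s \in F -> t \subset s -> t \in F.
Proof. exact: (chart_face ch). Qed.

(** These rays represent all classes, of ends as well as of coarse rays. *)
Definition straight_ray v r : Prop :=
  forall t, W (r t) = fun x => hval t * vertex v x.

Lemma straight_ray_exists v : [set v]%SET \in F -> exists r, straight_ray v r.
Proof.
move=> vF; apply: (chart_lift ch) => t.
by have [z <-] := vertex_point ch (halfline_ge0 t) vF; exact: (chart_adm ch).
Qed.

Lemma straight_ray_l1 v r t t' : straight_ray v r ->
  l1 (W (r t)) (W (r t')) = `|hval t - hval t'|.
Proof.
by move=> rE; rewrite !rE l1_lin ?mass_vertex ?mulr1// => x; exact: vertex_ge0.
Qed.

Lemma straight_ray_mass v r t : straight_ray v r -> mass (W (r t)) = hval t.
Proof. by move=> ->; rewrite massZ mass_vertex mulr1. Qed.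

Lemma straight_ray_coarse v r : straight_ray v r -> coarse r.
Proof.
move=> rE; apply/(coarse_rayP ch); split=> [d _|M].
  by exists d => t t' /ltW; rewrite (straight_ray_l1 _ _ rE).
by exists M => t; rewrite (straight_ray_mass _ rE).
Qed.

Lemma straight_ray_end v r : straight_ray v r -> end_rays Z r.
Proof.
move=> rE; split; last by have [] := straight_ray_coarse rE.
apply: (@lipschitz_cont _ _ _ _ C) => t t'.
by rewrite (le_trans (chart_dist ch _ _))// (straight_ray_l1 _ _ rE)
  halfline_dist distrC.
Qed.

Lemma straight_ray_label v r : [set v]%SET \in F -> straight_ray v r ->
  ray_label (F := F) (W := W) r (Some (fingraph.root (edge F) v)).
Proof.
move=> vF rE; exists 1 => t t1; apply: (component_supp F_sub).
  exact: (chart_supp ch).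
rewrite rE suppZ; last exact: lt_le_trans t1.
by rewrite supp_vertex !inE.
Qed.

Lemma coarse_straight_within (s : {set V}) f g : coarse f -> coarse g ->
  s \in F -> (forall t, supp (W (f t)) \subset s) ->
  (forall t, supp (W (g t)) \subset s) -> coarse_homotopic f g.
Proof.
move=> cf cg sF fs gs; apply: (coarse_homotopic_straight ch) => // t.
by apply: F_sub sF _; rewrite finset.subUset fs gs.
Qed.

Lemma supp_scale_vertex (c : R) v : 0 <= c ->
  supp (fun x => c * vertex v x) \subset [set v]%SET.
Proof.
move=> c0; apply/fintype.subsetP => u; rewrite !inE => h.
by apply/negPn/negP => uv; move: h; rewrite /vertex (negbTE uv) mulr0 ltxx.
Qed.

(** The straight rays over the two ends of an edge lie in the cone over that edge, where the
    straight homotopy applies. *)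
Lemma straight_rays_homotopic u v f g : [set u]%SET \in F ->
  connect (edge F) u v -> straight_ray u f -> straight_ray v g ->
  coarse_homotopic f g.
Proof.
move=> uF /connectP[p + ->].
elim: p u uF f => [|w p IH] u uF f /= => [_ fE gE|/andP[uw pw] fE gE].
  have -> : f = g.
    by apply/funext => t; apply: (chart_inj ch); rewrite fE gE.
  exact: coarse_homotopic_refl (straight_ray_coarse gE).
have wF := edge_vertexF ch uw; have [h hE] := straight_ray_exists wF.
apply: coarse_homotopic_trans (straight_ray_coarse hE) _ (IH w wF h pw hE gE).
apply: (coarse_straight_within (straight_ray_coarse fE) (straight_ray_coarse hE) uw).
  move=> t; rewrite fE; apply: fintype.subset_trans (supp_scale_vertex _ (halfline_ge0 t)) _.
  exact: finset.subsetUl.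
move=> t; rewrite hE; apply: fintype.subset_trans (supp_scale_vertex _ (halfline_ge0 t)) _.
exact: finset.subsetUr.
Qed.

Lemma coarse_comp (phi : halfline R -> halfline R) r :
  coarse phi -> coarse r -> coarse (r \o phi).
Proof.
move=> [cphi pphi] [cr pr]; split; last by move=> B /pr /pphi.
by move=> d /cphi[e e0 phie]; have [s s0 rs] := cr _ e0; exists s => // t t' /phie /rs.
Qed.

Definition root_time (t : halfline R) : R := Num.sqrt (hval t).

Lemma root_time_ge0 t : 0 <= root_time t.
Proof. exact: sqrtr_ge0. Qed.

Lemma root_timeK t : root_time t ^+ 2 = hval t.
Proof. by rewrite sqr_sqrtr// halfline_ge0. Qed.

Lemma root_time_proper t (M : R) : root_time t <= M -> hval t <= `|M| ^+ 2.
Proof.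
move=> tM; rewrite -root_timeK lerXn2r ?nnegrE ?root_time_ge0//.
exact: le_trans (ler_norm M).
Qed.

(* Taken to time [sqrt t] at height [sqrt t], a walk along edges has length at
   most of order [t], hence can be traced back in linear time. *)
Lemma walk_unwinds (p : nat -> V) f g : (forall j, edge F (p j) (p j.+1)) ->
  (forall t, W (f t) = unwind p (root_time t) 0) -> coarse f /\
  (straight_ray (p 0) g -> coarse_homotopic f g).
Proof.
move=> pF fE; have u0 := root_time_ge0.
have adm t s : 0 <= s <= hval t -> admissible F (unwind p (root_time t) s).
  by move=> /andP[_ st]; apply: unwind_admissible; rewrite ?root_timeK.
have ctl (d : R) t t' s s' : 0 <= s <= hval t -> 0 <= s' <= hval t' ->
    `|hval t - hval t'| < d -> `|s - s'| < d ->
    l1 (unwind p (root_time t) s) (unwind p (root_time t') s') <= 1 + 5 * d.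
  by move=> st st' tt' ss'; apply: unwind_controlled => //; rewrite !root_timeK.
have [f0 f0E] := chart_lift ch (fun t => adm t (hval t) (introT andP
  (conj (halfline_ge0 t) (lexx _)))).
have cf : coarse f.
  apply/(coarse_rayP ch); split=> [d d0|M].
    by exists (1 + 5 * d) => t t' tt'; rewrite !fE; apply: ctl;
      rewrite ?lexx ?halfline_ge0// subrr normr0.
  by exists (`|M| ^+ 2) => t; rewrite fE mass_unwind => /root_time_proper.
have cf0 : coarse f0.
  apply/(coarse_rayP ch); split=> [d d0|M].
    by exists (1 + 5 * d) => t t' tt'; rewrite !f0E; apply: ctl;
      rewrite ?lexx ?halfline_ge0.
  by exists (`|M| ^+ 2) => t; rewrite f0E mass_unwind => /root_time_proper.
(* Unwinding takes time [hval t] and ends at [f0], which has height [sqrt t] over [p 0]; a straight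
   homotopy over that vertex leads on to [g]. *)
split=> // gE; apply: (coarse_homotopic_trans cf0).
  apply: (coarse_homotopic_weights ch (q := id)
    (h := fun t s => unwind p (root_time t) s)) => //.
  - by apply: coarse_halflineP => [d _|M]; [exists d => t t' /ltW|exists M].
  - by move=> d d0; exists (1 + 5 * d) => t t' s s'; exact: ctl.
  - by move=> M; exists (`|M| ^+ 2) => t s _; rewrite mass_unwind => /root_time_proper.
have p0F : [set p 0]%SET \in F.
  by apply: F_sub (pF 0) _; rewrite finset.sub1set !inE eqxx.
apply: (coarse_straight_within cf0 (straight_ray_coarse gE) p0F) => t.
  rewrite f0E /unwind.
  have -> : root_time t - hval t / root_time t = 0.
    rewrite -root_timeK expr2; have [->|?] := eqVneq (root_time t) 0.
      by rewrite mul0r mul0r subrr.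
    by rewrite mulfK// subrr.
  by rewrite walk0; exact: supp_scale_vertex.
by rewrite gE; exact/supp_scale_vertex/halfline_ge0.
Qed.

(* Sampled at integers far out, a ray moves by less than the weight of a
   heaviest vertex, so that heaviest vertices of consecutive samples span an
   edge. *)
Lemma coarse_ray_straight r : coarse r -> exists v g,
  [/\ [set v]%SET \in F, straight_ray v g & coarse_homotopic r g].
Proof.
move=> cr; have [ctl prop] := (coarse_rayP ch r).1 cr.
have [e re] := ctl 2 (ltr0n _ 2).
have e0 : 0 <= e.
  by rewrite -(l1xx (W (r (hl 0)))); apply: re; rewrite subrr normr0.
(* Above this mass a heaviest vertex weighs more than [e + 1], so its weight stays positive under a
   change of at most [e]. *)
have [N rN] := prop (#|V|%:R * (e + 1)).
pose T := `|N| + 1; have T0 : 0 < T by rewrite ltr_wpDl.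
pose w (j : nat) := W (r (hl (T + j%:R))).
have Tj j : 0 <= T + j%:R by rewrite addr_ge0// ltW.
have wbig j : #|V|%:R * (e + 1) < mass (w j).
  rewrite ltNge; apply/negP => /rN; rewrite val_hl// leNgt => /negP; apply.
  by have := ler_norm N; have : 0 <= j%:R :> R by []; rewrite /T; lra.
have wpos j : 0 < mass (w j).
  by apply: le_lt_trans (wbig j); rewrite mulr_ge0// addr_ge0.
have wstep j : l1 (w j) (w j.+1) <= e.
  by apply: re; rewrite !val_hl// -natr1 ler0_norm; lra.
have /boolp.choice[m mE] : forall j, exists v, e + 1 < w j v.
  move=> j; have [v wv] := heavy_vertex (fun v => W_ge0 _ v) (wpos j).
  exists v; rewrite ltNge; apply/negP => h.
  have := lt_le_trans (wbig j) wv.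
  by rewrite ltNge ler_wpM2l.
(* The shift by one puts both [p j], heavy in the previous sample, and [p j.+1], heavy in this one,
   into the support of [w j]. So between times [j] and [j.+1] the walk stays in the simplex of that
   sample. *)
pose p (j : nat) := m j.-1.
have pw j : p j \in supp (w j) /\ p j.+1 \in supp (w j).
  rewrite !mem_supp /p; case: j => [|j] /=.
    by have := mE 0%N; split; lra.
  have := mE j.+1; have := mE j; have := l1_coord (w j) (w j.+1) (m j).
  by have := wstep j; split; lra.
have wF j : supp (w j) \in F by exact: (chart_supp ch).
have pF j : edge F (p j) (p j.+1).
  by have [? ?] := pw j; exact: (supp_edge F_sub (wF j)).
(* The slowed ray is held at sample [j] while [sqrt t] is between [j] and [j.+1], so it shares a
   simplex with the walk. *)
pose phi (t : halfline R) := hl (T + (Num.truncn (root_time t))%:R).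
have cphi : coarse phi.
  apply: coarse_halflineP => [d d0|M].
    (* [1 + d] comes from [sqr_dist], and 1 more from rounding down. *)
    exists (2 + d) => t t' tt'; rewrite !val_hl//.
    have := @sqr_dist _ (root_time t) (root_time t') d (root_time_ge0 t)
      (root_time_ge0 t').
    rewrite !root_timeK => /(_ tt'); rewrite !ler_norml => /andP[? ?].
    have /frac_itv/andP[? ?] := root_time_ge0 t.
    have /frac_itv/andP[? ?] := root_time_ge0 t'.
    by apply/andP; split; lra.
  exists (`|M| ^+ 2) => t; rewrite val_hl// => tM; apply: root_time_proper.
  by have /frac_itv/andP[? ?] := root_time_ge0 t; have := normr_ge0 N; rewrite /T in tM *; lra.
have st0 t : 0 <= root_time t ^+ 2 by rewrite sqr_ge0.
have admf t : admissible F (unwind p (root_time t) 0).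
  by apply: unwind_admissible => //; exact: root_time_ge0.
have [f fE] := chart_lift ch admf.
have p0F : [set p 0%N]%SET \in F.
  by apply: F_sub (pF 0%N) _; rewrite finset.sub1set !inE eqxx.
have [g gE] := straight_ray_exists p0F.
have [cf fg] := walk_unwinds g pF fE.
exists (p 0%N), g; split => //.
have crphi := coarse_comp cphi cr.
apply: (coarse_homotopic_trans crphi); first exact: (coarse_homotopic_reparam ch).
apply: (coarse_homotopic_trans cf) (fg gE).
apply: (coarse_homotopic_straight ch) => // t.
apply: F_sub (wF (Num.truncn (root_time t))) _.
rewrite finset.subUset; apply/andP; split; first by [].
rewrite fE; have [pj pj1] := pw (Num.truncn (root_time t)).
apply: fintype.subset_trans (supp_unwind p (root_time_ge0 t) (st0 t)) _.
rewrite mul0r subr0; apply/fintype.subsetP => x.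
by rewrite !inE => /orP[] /eqP ->; rewrite -mem_supp.
Qed.

Lemma same_label_coarse_homotopic f g k : coarse f -> coarse g ->
  ray_label (F := F) (W := W) f k -> ray_label (F := F) (W := W) g k ->
  coarse_homotopic f g.
Proof.
move=> cf cg fk gk.
have [u [f' [uF f'E ff']]] := coarse_ray_straight cf.
have [v [g' [vF g'E gg']]] := coarse_ray_straight cg.
have uk := ray_label_inj (straight_ray_label uF f'E)
  (coarse_homotopic_label ch ff' fk).
have vk := ray_label_inj (straight_ray_label vF g'E)
  (coarse_homotopic_label ch gg' gk).
apply: (coarse_homotopic_trans (straight_ray_coarse f'E) ff').
apply: (coarse_homotopic_trans (straight_ray_coarse g'E)); last first.
  exact: coarse_homotopic_sym.
apply: (straight_rays_homotopic uF) f'E g'E.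
by apply/(fingraph.rootP (edge_connect_sym F)); move: uk; rewrite -vk => -[].
Qed.

End coarse_classification.

(** * Coordinates on the cone over a geometric complex *)

Section linear_lower_bound.
Context {R : realType} {V : finType} {n : nat} (P : V -> 'rV[R]_n).

Definition lincomb (d : V -> R) : 'rV[R]_n := \sum_v d v *: P v.

Lemma lincombE d i : lincomb d 0 i = \sum_v d v * P v 0 i.
Proof. by rewrite summxE; apply: eq_bigr => v _; rewrite mxE. Qed.

Lemma lincombB d d' : lincomb (fun v => d v - d' v) = lincomb d - lincomb d'.
Proof. by rewrite -sumrB; apply: eq_bigr => v _; rewrite scalerBl. Qed.

Lemma lincombZ (a : R) d : lincomb (fun v => a * d v) = a *: lincomb d.
Proof. by rewrite scaler_sumr; apply: eq_bigr => v _; rewrite scalerA. Qed.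

Lemma enormZ (a : R) (x : 'rV[R]_n) : enorm (a *: x) = `|a| * enorm x.
Proof.
rewrite /enorm -sqrtr_sqr -sqrtrM ?sqr_ge0// mulr_sumr.
by congr Num.sqrt; apply: eq_bigr => i _; rewrite mxE exprMn.
Qed.

Lemma enorm_lincomb_le d : enorm (lincomb d) <= \sum_v `|d v| * enorm (P v).
Proof.
rewrite /lincomb; elim/big_ind2: _ => [|x a y b xa yb|v _].
- by rewrite /enorm big1 ?sqrtr0// => i _; rewrite mxE expr0n.
- by rewrite (le_trans (enormD _ _))// lerD.
- by rewrite enormZ.
Qed.

Lemma sum_continuous (I : finType) (T : topologicalType) (f : I -> T -> R) :
  (forall i, continuous (f i)) -> continuous (fun x => \sum_i f i x).
Proof. by move=> cf; apply: continuous_big => //; exact: add_continuous. Qed.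

(** By Tychonoff the box is compact, and so is its part of [l1] norm 1. The norms of its images form
    a closed set without 0, which misses a ball around 0. *)
Lemma box_lower_bound (a b : V -> R) :
  (forall d : V -> R, (forall v, a v <= d v <= b v) -> \sum_v `|d v| = 1 ->
     lincomb d != 0) ->
  exists2 c : R, 0 < c & forall d : V -> R, (forall v, a v <= d v <= b v) ->
     \sum_v `|d v| = 1 -> c <= enorm (lincomb d).
Proof.
move=> ne0; pose T : topologicalType := {ptws V -> R}.
pose box : set T := [set d | forall v, `[a v, b v]%classic (d v)].
pose sphere : set T := [set d | \sum_v `|d v| = 1].
have cproj v : continuous (fun d : T => d v) by move=> d; exact: proj_continuous.
have cbox : compact box.
  apply: (@tychonoff V (fun=> R) (fun v => `[a v, b v]%classic)) => v.
  exact: segment_compact.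
have csphere : closed sphere.
  apply: (@preimage_closed _ _ (fun d : T => \sum_v `|d v|) [set x | x = 1]).
    move=> d _; apply: sum_continuous => v {}d.
    apply: (@continuous_comp _ _ _ (fun d : T => d v) Num.norm).
      exact: cproj.
    exact: norm_continuous.
  exact: closed_eq.
have cf : continuous (fun d : T => enorm (lincomb d)).
  move=> d; apply: (@continuous_comp _ _ _
    (fun d : T => \sum_i lincomb d 0 i ^+ 2) Num.sqrt); last exact: sqrt_continuous.
  apply: sum_continuous => i {}d.
  apply: (@continuous_comp _ _ _ (fun d : T => lincomb d 0 i) (fun x => x ^+ 2)).
    have -> : (fun d : T => lincomb d 0 i) = (fun d : T => \sum_v d v * P v 0 i).
      by apply/funext => x; rewrite lincombE.
    apply: sum_continuous => v {}d.
    apply: (@continuous_comp _ _ _ (fun d : T => d v) (fun x => x * P v 0 i)).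
      exact: cproj.
    exact: mulrr_continuous.
  exact: exprn_continuous.
have := continuous_compact (continuous_subspaceT cf) (compact_closedI cbox csphere).
move=> /(compact_closed (@Rhausdorff R)) /closed_openC; rewrite openE => op.
have /op : (~` [set enorm (lincomb d) | d in box `&` sphere]) 0.
  move=> [d [bd sd]] /enorm0_eq0/eqP; apply/negP; apply: ne0 sd => v.
  by have := bd v; rewrite /= in_itv.
move=> /nbhs_ballP[c /= c0 cB]; exists c => // d bd sd.
rewrite leNgt; apply/negP => dc; apply: (cB (enorm (lincomb d))).
  by rewrite /ball/= sub0r normrN ger0_norm// enorm_ge0.
by exists d => //; split => // v; rewrite /= in_itv/= bd.
Qed.

End linear_lower_bound.

(** * The chart of the cone and its bi-Lipschitz bounds *)

Section geometric_chart.
Context {R : realType} {n : nat} {V : finType} (K : simplicial_complex V).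
Context {phi : realization R K -> euclidean R n}.
Hypotheses (phi_inj : injective phi) (phi_lin : linear_on_simplices phi).

(** The empty set is included only if there is some face: the cone over the empty complex is empty
    and has no apex. *)
Definition cone_faces : {set {set V}} :=
  [set s : {set V} | [exists t : {set V}, (t \in faces K) && (s \subset t)]]%SET.

Lemma cone_faces_sub (s t : {set V}) :
  s \in cone_faces -> t \subset s -> t \in cone_faces.
Proof.
rewrite !inE => /existsP[u /andP[uK su]] ts; apply/existsP; exists u.
by rewrite uK; exact: fintype.subset_trans su.
Qed.

Lemma weights_realization (w : V -> R) : admissible cone_faces w ->
  mass w = 1 -> w \in realization R K.
Proof.
move=> [w0 wF] w1; apply: mem_set; split => //.
move: wF; rewrite !inE => /existsP[t /andP[tK wt]].
apply: (faces_subset tK wt); apply/set0Pn; apply: mass_gt0P => //.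
by rewrite w1.
Qed.

Lemma realization_admissible (b : realization R K) :
  admissible cone_faces (\val b : V -> R) /\ mass (\val b : V -> R) = 1.
Proof.
have [b0 b1 bK] := set_valP b; split=> //; split=> //.
by rewrite inE; apply/existsP; exists (supp (\val b : V -> R)); rewrite bK subxx.
Qed.

(** Linearity gives vertex positions for each simplex separately. They agree because each is the
    image under [phi] of the vertex itself. *)
Lemma vertex_positions : exists p : V -> 'rV[R]_n,
  forall b : realization R K, phi b = \sum_v (\val b : V -> R) v *: p v.
Proof.
have /boolp.choice[p pE] : forall v, exists x : 'rV[R]_n,
    forall b : realization R K, (\val b : V -> R) = vertex v -> phi b = x.
  move=> v; have [[b bv]|nb] := pselect (exists b : realization R K,
    (\val b : V -> R) = vertex v).
    by exists (phi b) => b' b'v; congr phi; apply: val_inj; rewrite b'v bv.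
  (* An element of [V] in no face gets a default position, which always has coefficient 0. *)
  by exists 0 => b bv; exfalso; apply: nb; exists b.
exists p => b; have [b0 b1 bK] := set_valP b.
have b_out v : v \notin supp (\val b : V -> R) -> (\val b : V -> R) v = 0.
  by rewrite inE -leNgt => h; apply/le_anti; rewrite h b0.
have [a aE] := phi_lin bK; rewrite aE//.
rewrite [RHS](bigID (mem (supp (\val b : V -> R))))/= [X in _ + X]big1 ?addr0.
  apply: eq_bigr => v vb; congr (_ *: _).
  have vK : [set v]%SET \in faces K.
    by apply: (faces_subset bK); rewrite ?finset.sub1set//; apply/set0Pn;
      exists v; rewrite inE.
  have vR : vertex v \in realization R K.
    apply: weights_realization; last exact: mass_vertex.
    split=> [u|]; first exact: vertex_ge0.
    by rewrite supp_vertex inE; apply/existsP; exists [set v]%SET; rewrite vK subxx.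
  pose e : realization R K := exist _ (vertex v) vR.
  rewrite -(pE v e)// (aE e).
    rewrite (bigD1 v)//= big1 ?addr0; first by rewrite /vertex eqxx scale1r.
    by move=> u /andP[_ uv]; rewrite /vertex (negbTE uv) scale0r.
  move=> u ub; rewrite /= /vertex; case: eqP => // uv.
  by move: ub; rewrite uv vb.
by move=> v /b_out ->; rewrite scale0r.
Qed.

Section positions.
Context {p : V -> 'rV[R]_n}.
Hypothesis phiE : forall b : realization R K,
  phi b = \sum_v (\val b : V -> R) v *: p v.

(** With the vertices at height 1, the cone is parametrized by a linear map on weights: barycentric
    coordinates [b] at height [h] become the weights [h * b]. *)
Definition cone_vertex (v : V) : 'rV[R]_(n + 1) := row_mx (p v) (const_mx 1).

Local Notation point := (lincomb cone_vertex).

Lemma pointE w : point w = row_mx (\sum_v w v *: p v) (const_mx (mass w)).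
Proof.
apply/rowP => j; rewrite lincombE; case: (split_ordP j) => i ->.
  rewrite row_mxEl summxE; apply: eq_bigr => v _.
  by rewrite row_mxEl mxE.
by rewrite row_mxEr mxE; apply: eq_bigr => v _; rewrite row_mxEr mxE mulr1.
Qed.

(** The last coordinate recovers the mass. Mass 0 means the apex; otherwise division by the mass
    reduces the claim to injectivity of [phi]. *)
Lemma point_inj w w' : admissible cone_faces w -> admissible cone_faces w' ->
  point w = point w' -> w = w'.
Proof.
move=> aw aw'; rewrite !pointE => /eq_row_mx[pw mw].
have {}mw : mass w = mass w' by have := congr1 (fun A : 'M[R]_1 => A 0 0) mw; rewrite !mxE.
have [w0 wF] := aw; have [w'0 w'F] := aw'.
have := mass_ge0 w0; rewrite le_eqVlt => /orP[/eqP m0|m0].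
  apply/funext => v.
  have z (x : V -> R) : (forall v, 0 <= x v) -> mass x = 0 -> x v = 0.
    move=> x0 mx; apply/le_anti; rewrite x0 andbT leNgt; apply/negP => xv.
    by have := @supp_mass_gt0 _ _ x v x0; rewrite inE xv mx ltxx => /(_ isT).
  by rewrite !z// -mw.
have norm (x : V -> R) : admissible cone_faces x -> mass x = mass w ->
    (fun v => (mass w)^-1 * x v) \in realization R K.
  move=> [x0 xF] mx; apply: weights_realization; last first.
    by rewrite massZ mx mulVf// gt_eqF.
  split=> [v|]; first by rewrite mulr_ge0// invr_ge0 ltW.
  by rewrite suppZ// invr_gt0.
pose b : realization R K := exist _ (fun v => (mass w)^-1 * w v) (norm w aw erefl).
pose b' : realization R K := exist _ (fun v => (mass w)^-1 * w' v) (norm w' aw' (esym mw)).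
have bb' : b = b'.
  apply: phi_inj; rewrite !phiE /=.
  under eq_bigr do rewrite -scalerA.
  by under [RHS]eq_bigr do rewrite -scalerA; rewrite -!scaler_sumr pw.
apply/funext => v; have := congr1 (fun b : realization R K => (\val b : V -> R) v) bb'.
by move=> /(mulfI _); apply; rewrite invr_eq0 gt_eqF.
Qed.

(* If the value vanished, the positive and the negative part of [d] would be
   admissible weights of the same point. *)
Lemma point_neq0 (s t : {set V}) (d : V -> R) : s \in cone_faces ->
  t \in cone_faces -> (forall v, v \notin s -> d v <= 0) ->
  (forall v, v \notin t -> 0 <= d v) -> \sum_v `|d v| = 1 -> point d != 0.
Proof.
move=> sF tF ds dt d1; apply/eqP => d0.
pose x v := Num.max (d v) 0; pose y v := Num.max (- d v) 0.
have part (u : {set V}) (f : V -> R) : u \in cone_faces ->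
    (forall v, v \notin u -> f v <= 0) ->
    admissible cone_faces (fun v => Num.max (f v) 0).
  move=> uF fu; split=> [v|]; first by rewrite le_max lexx orbT.
  apply: cone_faces_sub uF _; apply/fintype.subsetP => v; rewrite mem_supp.
  by rewrite lt_max ltxx orbF => fv; apply: contraTT fv => /fu; rewrite leNgt.
have dE v : d v = x v - y v.
  by rewrite /x /y !maxEle; do !case: ifPn; rewrite -?ltNge; lra.
have xy : x = y.
  apply: point_inj; first exact: part sF ds.
    by apply: part tF _ => v /dt; rewrite oppr_le0.
  apply/eqP; rewrite -subr_eq0 -lincombB; apply/eqP; rewrite -[RHS]d0.
  by congr lincomb; apply/funext => v; rewrite dE.
move: d1; rewrite big1; first by move=> /esym/eqP; rewrite oner_eq0.
by move=> v _; rewrite dE xy subrr normr0.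
Qed.

(** A normalized difference of weights with supports [s] and [t] lies in the box of functions
    positive only on [s] and negative only on [t], with values between -1 and 1. There are finitely
    many such pairs. *)
Lemma point_lower_bound : exists2 c : R, 0 <= c & forall w w',
  admissible cone_faces w -> admissible cone_faces w' ->
  l1 w w' <= c * enorm (point w - point w').
Proof.
pose lo (t : {set V}) v : R := if v \in t then -1 else 0.
pose up (s : {set V}) v : R := if v \in s then 1 else 0.
have /boolp.choice[c cE] : forall st : {set V} * {set V}, exists c : R, 0 < c /\
    (st.1 \in cone_faces -> st.2 \in cone_faces -> forall d : V -> R,
      (forall v, lo st.2 v <= d v <= up st.1 v) -> \sum_v `|d v| = 1 ->
      c <= enorm (point d)).
  move=> [s t]; have [/andP[sF tF]|h] :=
    boolP ((s \in cone_faces) && (t \in cone_faces)); last first.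
    by exists 1; split => // sF tF; exfalso; move: h; rewrite sF tF.
  have [d dst d1|c c0 cP] := @box_lower_bound _ _ _ cone_vertex (lo t) (up s).
    apply: (point_neq0 sF tF) => // v vst; have := dst v;
    by rewrite /lo /up (negbTE vst) => /andP[].
  by exists c; split.
have c0 st : 0 < c st by have [] := cE st.
(* The sum dominates each of its terms, so one constant serves all pairs. *)
exists (\sum_st (c st)^-1); first by apply: sumr_ge0 => st _; rewrite invr_ge0 ltW.
move=> w w' [w0 wF] [w'0 w'F]; set l := l1 w w'; pose st := (supp w, supp w').
have := l1_ge0 w w'; rewrite -/l le_eqVlt => /orP[/eqP <-|l0].
  rewrite mulr_ge0 ?enorm_ge0//.
  by apply: sumr_ge0 => ? _; rewrite invr_ge0 ltW.
have li0 : 0 <= l^-1 by rewrite invr_ge0 ltW.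
pose d v := l^-1 * (w v - w' v).
have ld (v : V) : `|w v - w' v| <= l by rewrite /l /l1 (bigD1 v)//= lerDl sumr_ge0.
have d1 v : -1 <= d v <= 1.
  rewrite -ler_norml normrM [`|l^-1|]ger0_norm//.
  by rewrite mulrC ler_pdivrMr// mul1r.
have out (x : V -> R) v : (forall v, 0 <= x v) -> v \notin supp x -> x v = 0.
  by move=> x0; rewrite inE -leNgt => h; apply/le_anti; rewrite h x0.
have cd : c st <= enorm (point d).
  have [_] := cE st; apply => // [v|].
    have /andP[? ?] := d1 v.
    rewrite /lo /up; apply/andP; split; case: ifPn => // h.
      by rewrite /d (out w' v)// subr0 mulr_ge0.
    by rewrite /d (out w v)// sub0r mulrN oppr_le0 mulr_ge0.
  rewrite /d; under eq_bigr do rewrite normrM.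
  by rewrite -mulr_sumr [`|l^-1|]ger0_norm// mulVf// gt_eqF.
have {cd} : l <= (c st)^-1 * enorm (point w - point w').
  rewrite -lincombB; move: cd; rewrite /d lincombZ enormZ [`|l^-1|]ger0_norm//.
  by rewrite ![_^-1 * _]mulrC !ler_pdivlMr// mulrC.
move=> /le_trans; apply; rewrite ler_wpM2r ?enorm_ge0//.
rewrite (bigD1 st)//= lerDl; apply: sumr_ge0 => ? _; by rewrite invr_ge0 ltW.
Qed.

Lemma cone_pointP (z : euclidean R (n + 1)) : cone (range phi) z <->
  exists2 w, admissible cone_faces w & z = point w.
Proof.
split=> [[h [x [h0 [b _ bx] zE]]]|[w aw ->]].
  have [[b0 bF] b1] := realization_admissible b.
  exists (fun v => h * (\val b : V -> R) v).
    split=> [v|]; first by rewrite mulr_ge0.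
    apply: cone_faces_sub bF _; apply/fintype.subsetP => v; rewrite !mem_supp => hb.
    rewrite lt_neqAle b0 andbT; apply/eqP => bv.
    by move: hb; rewrite -bv mulr0 ltxx.
  rewrite zE pointE massZ b1 mulr1 -bx phiE scaler_sumr; congr row_mx.
  by apply: eq_bigr => v _; rewrite scalerA.
have [w0 wF] := aw; rewrite pointE.
have := mass_ge0 w0; rewrite le_eqVlt => /orP[/eqP m0|m0]; last first.
  have bK : (fun v => (mass w)^-1 * w v) \in realization R K.
    apply: weights_realization; last by rewrite massZ mulVf// gt_eqF.
    split=> [v|]; first by rewrite mulr_ge0// invr_ge0 ltW.
    by rewrite suppZ// invr_gt0.
  pose b : realization R K := exist _ (fun v => (mass w)^-1 * w v) bK.
  exists (mass w), (phi b); split; [exact: ltW|by exists b|].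
  congr row_mx; rewrite phiE scaler_sumr; apply: eq_bigr => v _.
  by rewrite /= scalerA mulrA divff ?mul1r// gt_eqF.
(* The apex must be written over some point of the complex. As the support of [w] lies in a face,
   there is a vertex to take. *)
move: wF; rewrite inE => /existsP[t /andP[tK _]].
have /set0Pn[v vt] : t != finset.set0.
  by apply/eqP => t0; move: tK; rewrite t0 (negbTE (faces_neq0 K)).
have bK : vertex v \in realization R K.
  apply: weights_realization; last exact: mass_vertex.
  split=> [u|]; first exact: vertex_ge0.
  by rewrite supp_vertex inE; apply/existsP; exists t; rewrite tK finset.sub1set.
pose b : realization R K := exist _ (vertex v) bK.
exists (mass w), (phi b); split; [by rewrite -m0|by exists b|].
congr row_mx; rewrite -m0 scale0r big1// => u _.
suff -> : w u = 0 by rewrite scale0r.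
apply/le_anti; rewrite w0 andbT leNgt; apply/negP => wu.
by have := @supp_mass_gt0 _ _ w u w0; rewrite inE wu -m0 ltxx => /(_ isT).
Qed.

Lemma cone_chart_exists : exists (W : cone (range phi) -> V -> R) (C : R),
  cone_chart cone_faces W C.
Proof.
have /boolp.choice[W WP] : forall z : cone (range phi), exists w : V -> R,
    admissible cone_faces w /\ \val z = point w.
  by move=> z; have [w aw zE] := (cone_pointP _).1 (set_valP z); exists w.
have [c c0 cP] := point_lower_bound.
pose m := \sum_v enorm (cone_vertex v).
have m0 : 0 <= m by apply: sumr_ge0 => v _; exact: enorm_ge0.
have distE z z' : mdist z z' = enorm (point (W z) - point (W z')).
  by rewrite -!(WP _).2.
exists W, (c + m + 1); split.
- by rewrite ltr_wpDl// addr_ge0.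
- exact: cone_faces_sub.
- by move=> z; have [] := WP z.
- move=> w aw; have zc : point w \in cone (range phi).
    by apply: mem_set; apply/cone_pointP; exists w.
  exists (exist _ (point w) zc); apply: point_inj => //; first by have [] := WP (exist _ (point w) zc).
  by rewrite -(WP _).2.
- move=> z z'; rewrite distE -lincombB (le_trans (enorm_lincomb_le _ _))//.
  rewrite mulrC /l1 mulr_suml; apply: ler_sum => v _; rewrite ler_wpM2l//.
  rewrite (@le_trans _ _ m)//; last lra.
  by rewrite /m (bigD1 v)//= lerDl; apply: sumr_ge0 => u _; exact: enorm_ge0.
- move=> z z'; rewrite distE (le_trans (cP _ _ (WP z).1 (WP z').1))//.
  by rewrite ler_wpM2r ?enorm_ge0//; lra.
Qed.

End positions.

End geometric_chart.

(** * Comparison of the two quotients *)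

Section eq_quot_bijection.
Local Open Scope quotient_scope.
Context {I : Type} {T1 T2 : choiceType}.
Context (e1 : equiv_rel T1) (e2 : equiv_rel T2) (f1 : T1 -> I) (f2 : T2 -> I).
Hypothesis e1P : forall x y, e1 x y <-> f1 x = f1 y.
Hypothesis e2P : forall x y, e2 x y <-> f2 x = f2 y.
Hypothesis f12 : forall x, exists y, f2 y = f1 x.
Hypothesis f21 : forall y, exists x, f1 x = f2 y.

(** Both quotients are identified with the common image of [f1] and [f2]. *)
Lemma eq_quot_bijection :
  exists f : {eq_quot e1} -> {eq_quot e2}, bijective f.
Proof.
have /boolp.choice[g gE] := f12; have /boolp.choice[h hE] := f21.
have r1 x : f1 (repr (\pi_{eq_quot e1} x)) = f1 x.
  by apply/e1P/eqmodP; rewrite reprK.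
have r2 y : f2 (repr (\pi_{eq_quot e2} y)) = f2 y.
  by apply/e2P/eqmodP; rewrite reprK.
exists (fun q => \pi_{eq_quot e2} (g (repr q))).
exists (fun q => \pi_{eq_quot e1} (h (repr q))) => q.
  by rewrite -[RHS]reprK; apply/eqmodP/e1P; rewrite hE r2 gE.
by rewrite -[RHS]reprK; apply/eqmodP/e2P; rewrite gE r1 hE.
Qed.

End eq_quot_bijection.

Lemma ends_pi0_bijection (R : realType) (V : finType) (Z : metricType R)
    (F : {set {set V}}) (W : Z -> V -> R) (C : R) : cone_chart F W C ->
  exists f : Ends Z -> pi0_crs Z, bijective f.
Proof.
move=> ch; pose label := @ray_label R V Z F W.
have /boolp.choice[f1 f1P] : forall r : end_rays Z, exists k, label (\val r) k.
  move=> r; have [v [_ rv]] := end_ray_label ch (set_valP r).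
  by exists (Some (fingraph.root (edge F) v)).
have /boolp.choice[f2 f2P] : forall r : coarse_rays Z, exists k, label (\val r) k.
  move=> r; have [v [_ rv]] := coarse_ray_label ch (set_valP r).
  by exists (Some (fingraph.root (edge F) v)).
apply: (eq_quot_bijection (f1 := f1) (f2 := f2)).
- move=> r r'; split=> [/asboolP h|h]; first exact: (ends_equiv_label ch h (f1P r) (f1P r')).
  apply/asboolP; have [_ pr] := set_valP r; have [_ pr'] := set_valP r'.
  by apply: (same_label_ends_equiv ch pr pr' (f1P r)); rewrite h; exact: f1P.
- move=> r r'; split=> [/asboolP h|h].
    exact: (ray_label_inj (coarse_homotopic_label ch h (f2P r)) (f2P r')).
  apply/asboolP; have cr := set_valP r; have cr' := set_valP r'.
  by apply: (same_label_coarse_homotopic ch cr cr' (f2P r)); rewrite h; exact: f2P.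
(* The straight ray over a vertex is both an end ray and a coarse ray, so the same labels occur on
   both sides. *)
- move=> r; have [v [vF rv]] := end_ray_label ch (set_valP r).
  have [s sE] := straight_ray_exists ch vF.
  have sc : s \in coarse_rays Z by apply: mem_set; exact: (straight_ray_coarse ch sE).
  exists (exist _ s sc); rewrite (ray_label_inj (f1P r) rv).
  exact: (ray_label_inj (f2P (exist _ s sc)) (straight_ray_label ch vF sE)).
- move=> r; have [v [vF rv]] := coarse_ray_label ch (set_valP r).
  have [s sE] := straight_ray_exists ch vF.
  have sc : s \in end_rays Z by apply: mem_set; exact: (straight_ray_end ch sE).
  exists (exist _ s sc); rewrite (ray_label_inj (f2P r) rv).
  exact: (ray_label_inj (f1P (exist _ s sc)) (straight_ray_label ch vF sE)).
Qed.

Theorem corollary7p2 (R : realType) (n : nat) (X : set (euclidean R n))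
    (hX : geometric_simplicial_complex X) :
  exists f : Ends (cone X) -> pi0_crs (cone X), bijective f.
Proof.
have [V [K [phi [[phi_inj _ _] phi_lin ->]]]] := hX.
have [p phiE] := vertex_positions phi_lin.
have [W [C ch]] := cone_chart_exists phi_inj phiE.
exact: (ends_pi0_bijection ch).
Qed.
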